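(* Let $A$ be an Artin algebra, let $n\geq 0$, and suppose that $A$ is $n$-Igusa--Todorov with witness $V$. Let $t=t(V)$ be the number of isomorphism classes of nonprojective indecomposable direct summands of $V$. If $M$ is a finitely generated left $A$-module such that $\operatorname{Ext}_A^i(M,A)=0$ for every $i>0$ and $$\operatorname{Ext}_A^q(M,M)=0\quad\text{for all } 1\leq q\leq 2t+1,$$ then $M$ is projective. Consequently, every Igusa--Todorov Artin algebra $A$ satisfies the Auslander--Reiten conjecture, i.e. every finitely generated left $A$-module $M$ with $\operatorname{Ext}_A^i(M,M\oplus A)=0$ for all $i>0$ is projective.
   Context: An Artin algebra is an algebra $A$ over a commutative Artinian ring $R$ that is finitely generated as an $R$-module. All modules are finitely generated left modules. For a module $V$, $\operatorname{add}V$ is the full subcategory of direct summands of finite direct sums of copies of $V$. For a module $X$, $\Omega X$ is the kernel of a projective cover $P_X\twoheadrightarrow X$; $\Omega^0X=X$ and $\Omega^{n+1}X=\Omega(\Omega^nX)$. The algebra $A$ is $n$-Igusa--Todorov (for an integer $n\ge 0$) if there is a module $V$ such that every module $Y$ admits an exact sequence $0\to V_1\to V_0\to\Omega^nY\to 0$ with $V_0,V_1\in\operatorname{add}V$; such a $V$ is called an ($n$-Igusa--Todorov) witness. $A$ is Igusa--Todorov if it is $n$-Igusa--Todorov for some $n\geq 0$. *)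

(* Defs.v *)
From HB Require Import structures.
From mathcomp Require Import all_boot all_algebra.

Set Implicit Arguments.
Unset Strict Implicit.
Unset Printing Implicit Defensive.

Import GRing.Theory.
Local Open Scope ring_scope.

(* Subsets are Prop-valued, so that no decidability of ideals is presupposed. *)
Definition is_ideal (R : comPzRingType) (I : R -> Prop) : Prop :=
  [/\ I 0, forall x y, I x -> I y -> I (x + y) & forall a x, I x -> I (a * x)].

Definition artinian (R : comPzRingType) : Prop :=
  forall I : nat -> R -> Prop,
    (forall n, is_ideal (I n)) ->
    (forall n x, I n.+1 x -> I n x) ->
    exists N, forall n, (N <= n)%N -> forall x, I n x <-> I N x.

Definition finitely_generated (S : pzRingType) (M : lmodType S) : Prop :=
  exists (k : nat) (g : 'I_k -> M),
    forall x : M, exists c : 'I_k -> S, x = \sum_(j < k) c j *: g j.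

Definition artin_algebra (R : comPzRingType) (A : algType R) : Prop :=
  artinian R /\ finitely_generated (A : lmodType R).

Section Modules.

Variable A : pzRingType.

Implicit Types M N U V W X Y Z P : lmodType A.

Definition surjective (U V : Type) (f : U -> V) : Prop :=
  forall y, exists x, f x = y.

(* Exactness of U -> V -> W at V. *)
Definition exact U V W (f : U -> V) (g : V -> W) : Prop :=
  forall y : V, g y = 0 <-> exists x : U, f x = y.

Definition isomorphic U V : Prop := exists f : {linear U -> V}, bijective f.

Definition zero_module U : Prop := forall x : U, x = 0.

Definition projective P : Prop :=
  forall U V (g : {linear U -> V}) (f : {linear P -> V}),
    surjective g -> exists h : {linear P -> U}, forall x, g (h x) = f x.

Definition direct_summand X Y : Prop :=
  exists W, isomorphic (X * W)%type Y.

Definition in_add V X : Prop :=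
  exists k : nat, direct_summand X {ffun 'I_k -> V}.

Definition indecomposable X : Prop :=
  ~ zero_module X /\
  forall U W, isomorphic (U * W)%type X -> zero_module U \/ zero_module W.

Definition short_exact U V W (f : {linear U -> V}) (g : {linear V -> W}) : Prop :=
  [/\ injective f, exact f g & surjective g].

(* The minimality condition says that p is an essential epimorphism. *)
Definition projective_cover P X (p : {linear P -> X}) : Prop :=
  [/\ projective P, surjective p &
      forall U (g : {linear U -> P}), surjective (p \o g) -> surjective g].

(* Omega is only defined up to isomorphism, so it is given as a relation:
   [is_syzygy n X Z] says that Z is (a model of) Omega^n X. *)
Definition is_syzygy1 X Z : Prop :=
  exists P (i : {linear Z -> P}) (p : {linear P -> X}),
    projective_cover p /\ short_exact i p.

Fixpoint is_syzygy (n : nat) X Z : Prop :=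
  if n is m.+1 then exists Y, is_syzygy m X Y /\ is_syzygy1 Y Z
  else isomorphic X Z.

Record projective_resolution M := ProjectiveResolution {
  res_mod :> nat -> lmodType A;
  res_diff : forall i, {linear res_mod i.+1 -> res_mod i};
  res_aug : {linear res_mod 0 -> M};
  res_projective : forall i, projective (res_mod i);
  res_aug_surj : surjective res_aug;
  res_exact0 : exact (res_diff 0) res_aug;
  res_exactS : forall i, exact (res_diff i.+1) (res_diff i) }.

Definition cocycle M (P : projective_resolution M) N (q : nat)
    (f : {linear P q -> N}) : Prop :=
  forall x, f (res_diff P q x) = 0.

Definition coboundary M (P : projective_resolution M) N (q : nat) :
    {linear P q -> N} -> Prop :=
  match q return {linear P q -> N} -> Prop with
  | 0 => fun f => forall x, f x = 0
  | r.+1 => fun f =>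
      exists g : {linear P r -> N}, forall x, f x = g (res_diff P r x)
  end.

(* Ext^q_A(M, N) = 0: the q-th cohomology of Hom_A(P, N) vanishes, for P a
   projective resolution of M. This does not depend on the resolution, whence
   the universal quantification. *)
Definition Ext_zero (q : nat) M N : Prop :=
  forall (P : projective_resolution M) (f : {linear P q -> N}),
    cocycle f -> coboundary f.

Definition IT_witness (n : nat) V : Prop :=
  finitely_generated V /\
  forall Y, finitely_generated Y ->
    exists Z V0 V1 (i : {linear V1 -> V0}) (p : {linear V0 -> Z}),
      [/\ is_syzygy n Y Z, in_add V V0, in_add V V1 & short_exact i p].

Definition nonproj_indec_summand V X : Prop :=
  [/\ direct_summand X V, indecomposable X & ~ projective X].

(* t(V) = t: there is a system of representatives, indexed by 'I_t, of the
   isomorphism classes of nonprojective indecomposable summands of V. *)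
Definition num_nonproj_indec_summands V (t : nat) : Prop :=
  exists X : 'I_t -> lmodType A,
    [/\ forall j, nonproj_indec_summand V (X j),
        forall j k, isomorphic (X j) (X k) -> j = k &
        forall Y, nonproj_indec_summand V Y -> exists j, isomorphic Y (X j)].

End Modules.

Definition n_Igusa_Todorov (A : pzRingType) (n : nat) : Prop :=
  exists V : lmodType A, IT_witness n V.

Definition Igusa_Todorov (A : pzRingType) : Prop :=
  exists n : nat, n_Igusa_Todorov A n.

Definition Auslander_Reiten (A : pzRingType) : Prop :=
  forall M : lmodType A, finitely_generated M ->
    (forall i, (0 < i)%N -> Ext_zero i M (M * A^o)%type) ->
    projective M.

(* Main.v *)
From HB Require Import structures.
From mathcomp Require Import all_boot all_algebra.
From mathcomp Require Import boolp classical_sets functions.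
From mathcomp Require Import zify.
Require Import Defs.

(** Suppose that [M] is not projective, and let Z_s, for n <= s <= n + 2t, be an
s-th syzygy of [M] that has a presentation 0 -> V1 -> V0 -> Z_s -> 0 by modules of
add V. As Ext^i(M, A) = 0 for i > 0, no Z_s is projective, and dimension shifting
gives Ext^i(M, Z_s) = Ext^(i-s)(M, M) = 0 for s < i <= s + 2t + 1.

Let e_i(N) be the length over [R] of Ext^i(M, N). The function e_i is additive on
direct sums and vanishes on projective modules, so on add V it is determined by
its values at the t nonprojective indecomposable summands X_k of V. Thus
e_i(V0) - e_i(V1) = e_i . d_s, where e_i is now a vector of length t and d_s is a
vector of multiplicities. The long exact sequence for Ext(M, -) shows that
e_i . d_s = 0 for s + 2 <= i <= s + 2t + 1 ([ext_length_eq]).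

In degree i = s + 1 the map from Ext^i(M, V1) to Ext^i(M, V0) is surjective. If
e_i . d_s = 0 it is injective too; then the identity of Z_s lifts to V0 in the
stable category, and Z_s is a summand of V0 + P with P projective
([retract_of_ext_length_eq]). Then a nonprojective indecomposable summand of Z_s
is one of the X_k. Different s have different such k, as the stable homomorphisms
from Z_s' to Z_s form Ext^(s'-s)(M, M) = 0 for s < s' ([syzygy_no_common_summand]).
Hence this happens for at most t of the 2t + 1 values of s. The remaining values,
at least t + 1, give a triangular matrix e_(s'+1) . d_s with nonzero diagonal,
whose rank is at most t: a contradiction ([triangular_rank]).

The algebra needed for this is built on lengths measured by chains of
submodules: Artinian commutative rings have finite length
([artinian_finite_length]), which gives Noetherianity, Fitting's lemma
([fitting]) and decompositions into indecomposable modules with local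
endomorphism rings. *)

Set Implicit Arguments.
Unset Strict Implicit.
Unset Printing Implicit Defensive.

Import GRing.Theory.
Local Open Scope ring_scope.

(** * Linear maps *)

Section LinearMaps.

Variable S : pzRingType.
Implicit Types U V W : lmodType S.

Definition lin_of U V (f : U -> V) (fP : linear f) : {linear U -> V} :=
  HB.pack f (GRing.isLinear.Build S U V *:%R f fP).

Lemma pair_linear U V W (f : {linear U -> V}) (g : {linear U -> W}) :
  linear (fun x => (f x, g x)).
Proof. by move=> a x y; rewrite !linearP. Qed.

End LinearMaps.

(** * Chains of submodules and length *)

Section Chains.

Variables (S : pzRingType) (sc : S -> Prop).

(** The scalars are restricted to [sc] because Hom_A(X, N) is not an A-submodule
of the module of functions from X to N when A is an algebra over a commutative
ring R; it is closed under the scalars that come from R. *)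
Record submod (H : lmodType S) (B : H -> Prop) : Prop := Submod {
  submod0 : B 0;
  submodB : forall x y, B x -> B y -> B (x - y);
  submodZ : forall a x, sc a -> B x -> B (a *: x) }.

Section OneModule.

Variable H : lmodType S.
Implicit Types B C D : H -> Prop.

(** [n] strict steps below [C], the last term lying above [B]. Measuring [C / B]
by chains between [B] and [C] avoids quotient modules. *)
Fixpoint chain (n : nat) (B C : H -> Prop) : Prop :=
  if n is m.+1 then
    exists2 C', [/\ submod C', forall x, C' x -> C x & exists2 x, C x & ~ C' x]
              & chain m B C'
  else forall x, B x -> C x.

Definition bounded B C := exists n, ~ chain n.+1 B C.

(** The length of [C / B]; the default value 0 stands for infinite length. *)
Definition len B C : nat :=
  if pselect (exists n, `[< ~ chain n.+1 B C >]) is left h then ex_minn h else 0.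

Lemma submodN B x : submod B -> B x -> B (- x).
Proof. by move=> sB Bx; rewrite -sub0r; apply: submodB => //; apply: submod0. Qed.

Lemma submodD B x y : submod B -> B x -> B y -> B (x + y).
Proof. by move=> sB Bx By; rewrite -[y]opprK; apply: submodB => //; apply: submodN. Qed.

Lemma submod_zero : submod (fun x : H => x = 0).
Proof.
split=> // [x y -> ->|a x _ ->]; by rewrite ?subr0 ?scaler0.
Qed.

Lemma submod_full : submod (fun _ : H => True).
Proof. by []. Qed.

Lemma submod_sum k (B : H -> Prop) (f : 'I_k -> H) :
  submod B -> (forall i, B (f i)) -> B (\sum_(i < k) f i).
Proof.
move=> sB Bf; elim/big_ind: _ => //; first exact: submod0.
by move=> x y; apply: submodD.
Qed.

Lemma chain_sub n B C : chain n B C -> forall x, B x -> C x.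
Proof.
by elim: n C => [|n IH] C //= [C' [_ sC _] /IH h] x /h /sC.
Qed.

Lemma chain_weaken n B B' C C' :
  (forall x, B' x -> B x) -> (forall x, C x -> C' x) ->
  chain n B C -> chain n B' C'.
Proof.
elim: n C C' => [|n IH] C C' sB sC /=; first by move=> h x /sB /h /sC.
case=> D [sD DC [x Cx nDx]] ch; exists D; last exact: IH ch.
by split=> // [y /DC /sC //|]; exists x => //; apply: sC.
Qed.

Lemma chain_leq m n B C : (m <= n)%N -> chain n B C -> chain m B C.
Proof.
elim: n => [|n IH]; first by case: m.
rewrite leq_eqVlt => /predU1P[-> //|/IH h] /= [D [_ DC _] ch].
by apply: h; apply: chain_weaken ch.
Qed.

Lemma chain_cat m n B C D :
  submod D -> chain n B D -> chain m D C -> chain (m + n) B C.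
Proof.
move=> sD ch; elim: m C => [|m IH] C /=; first by move=> h; apply: chain_weaken ch.
by case=> C' h /IH ch'; exists C'.
Qed.

Lemma chain1 B C x :
  submod B -> (forall y, B y -> C y) -> C x -> ~ B x -> chain 1 B C.
Proof. by move=> sB BC Cx nBx; exists B => //; split=> //; exists x. Qed.

(** The modular law: a strict step of a chain stays strict in the trace on [D]
or in the sum with [D]. *)
Lemma chain_split n B C D :
  submod C -> submod D -> (forall x, B x -> D x) -> chain n B C ->
  exists a b, [/\ n = (a + b)%N, chain a B (fun x => C x /\ D x) &
    chain b D (fun x => exists2 y, C y & D (x - y))].
Proof.
move=> sC sD BD; elim: n C sC => [|n IH] C sC /=.
  move=> BC; exists 0%N, 0%N; split=> //= x.
    by move=> Bx; split; [apply: BC|apply: BD].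
  by exists 0; rewrite ?subr0 //; apply: submod0.
case=> C' [sC' C'C [x Cx nC'x]] /(IH _ sC') [a [b [-> cha chb]]].
case: (pselect (forall y, C y -> D y -> C' y)) => hD; last first.
  exists a.+1, b; split; rewrite ?addSn //; last first.
    by apply: chain_weaken chb => // y [z /C'C]; exists z.
  exists (fun x => C' x /\ D x) => //; split.
  - split=> [|y z [? ?] [? ?]|s y ? [? ?]]; split;
      by [apply: submod0|apply: submodB|apply: submodZ].
  - by move=> y [/C'C].
  - move/existsNP: hD => [y /not_implyP[Cy /not_implyP[Dy nC'y]]].
    by exists y => // -[].
exists a, b.+1; split; rewrite ?addnS //.
  by apply: chain_weaken cha => // y [/C'C].
exists (fun x => exists2 y, C' y & D (x - y)) => //; split.
- split=> [|y z [y' ? ?] [z' ? ?]|s y ? [y' ? ?]].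
  + by exists 0; rewrite ?subr0; apply: submod0.
  + exists (y' - z'); first exact: submodB.
    have -> : y - z - (y' - z') = (y - y') - (z - z').
      by rewrite !opprB addrACA [in RHS]addrACA [- z - y']addrC.
    exact: submodB.
  + by exists (s *: y'); rewrite -?scalerBr; apply: submodZ.
- by move=> y [z /C'C]; exists z.
- exists x; first by exists x => //; rewrite subrr; apply: submod0.
  case=> y C'y Dxy; apply: nC'x; rewrite -[x](subrK y).
  by apply: submodD => //; apply: hD => //; apply: submodB => //; apply: C'C.
Qed.

Lemma len_chain n B C : bounded B C -> (forall x, B x -> C x) ->
  chain n B C <-> (n <= len B C)%N.
Proof.
move=> [m bm] BC; rewrite /len; case: pselect => [h|[]]; last first.
  by exists m; apply/asboolP.
case: ex_minnP => k /asboolP nk kmin; split=> [ch|].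
  by rewrite leqNgt; apply/negP => lt_kn; apply: nk; apply: chain_leq ch.
case: n => [//|n] lt_nk; apply: contrapT => /asboolP /kmin.
by rewrite leqNgt lt_nk.
Qed.

Lemma len_le n B C : bounded B C -> chain n B C -> (n <= len B C)%N.
Proof. by move=> bd ch; apply/len_chain => //; apply: chain_sub ch. Qed.

Lemma bounded_len B C : bounded B C -> (forall x, B x -> C x) ->
  chain (len B C) B C.
Proof. by move=> bd BC; apply/len_chain. Qed.

Lemma bounded_weaken B B' C C' :
  (forall x, B x -> B' x) -> (forall x, C' x -> C x) ->
  bounded B C -> bounded B' C'.
Proof. by move=> sB sC [n nch]; exists n => ch; apply: nch; apply: chain_weaken ch. Qed.

(** Chains can be concatenated at [D], and by [chain_split] no chain is longer than
those obtained in this way. *)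
Lemma bounded_cat B C D :
  submod C -> submod D -> (forall x, B x -> D x) -> (forall x, D x -> C x) ->
  bounded B D -> bounded D C ->
  bounded B C /\ len B C = (len B D + len D C)%N.
Proof.
move=> sC sD BD DC bBD bDC.
have BC x : B x -> C x by move/BD/DC.
have key n : chain n B C -> (n <= len B D + len D C)%N.
  move=> /(chain_split sC sD BD) [a [b [-> cha chb]]]; apply: leq_add.
    by apply: len_le => //; apply: chain_weaken cha => // x [].
  apply: len_le => //; apply: chain_weaken chb => // x [y Cy /DC].
  by move/(submodD sC)/(_ Cy); rewrite subrK.
have bBC : bounded B C.
  by exists (len B D + len D C)%N => /key; rewrite ltnn.
split=> //; apply/eqP; rewrite eqn_leq key ?len_le //; last exact: bounded_len.
by rewrite addnC; apply: chain_cat sD _ _; apply: bounded_len.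
Qed.

(** [m] strict steps of the sequence form a chain of length [m]. *)
Lemma ascending_stop (B : nat -> H -> Prop) D C :
  (forall m, submod (B m)) -> (forall m x, B m x -> B m.+1 x) ->
  (forall x, D x -> B 0%N x) -> (forall m x, B m x -> C x) -> bounded D C ->
  exists m, forall x, B m.+1 x -> B m x.
Proof.
move=> sB incB DB BC [n nch]; apply: contrapT => /forallNP strict.
apply: nch; have ch m : chain m D (B m).
  elim: m => [|m IH] //; exists (B m) => //; split=> //; first exact: incB.
  by have /existsNP[x /not_implyP[? ?]] := strict m; exists x.
by apply: chain_weaken (ch n.+1) => // x; apply: BC.
Qed.

Lemma descending_stop (B : nat -> H -> Prop) D C :
  (forall m, submod (B m)) -> (forall m x, B m.+1 x -> B m x) ->
  (forall x, B 0%N x -> C x) -> (forall m x, D x -> B m x) -> bounded D C ->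
  exists m, forall x, B m x -> B m.+1 x.
Proof.
move=> sB decB BC DB [n nch]; apply: contrapT => /forallNP strict.
apply: nch; have ch m : chain m (B m) (B 0%N).
  elim: m => [|m IH] //; rewrite -{1}addn1; apply: chain_cat (sB m) _ IH.
  have /existsNP[x /not_implyP[? ?]] := strict m.
  by apply: (@chain1 _ _ x) => //; apply: decB.
by apply: chain_weaken (ch n.+1) => // x; apply: DB.
Qed.

End OneModule.

Section TwoModules.

Variables (H H' : lmodType S) (f : {linear H -> H'}).
Variables (B C : H -> Prop) (B' C' : H' -> Prop).
Hypotheses (sC : submod C).

Lemma submod_preim (D : H' -> Prop) : submod D -> submod (fun x => C x /\ D (f x)).
Proof.
move=> sD; split=> [|x y [? ?] [? ?]|a x ? [? ?]];
  rewrite ?linear0 ?linearB ?linearZ; split;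
  by [apply: submod0|apply: submodB|apply: submodZ].
Qed.

Lemma submod_im (D : H -> Prop) : submod D ->
  submod (fun y => exists2 x, D x & f x = y).
Proof.
move=> sD; split=> [|_ _ [x Dx <-] [y Dy <-]|a _ sa [x Dx <-]].
- by exists 0; [apply: submod0|rewrite linear0].
- by exists (x - y); [apply: submodB|rewrite linearB].
- by exists (a *: x); [apply: submodZ|rewrite linearZ].
Qed.

Lemma chain_preim n : submod C' ->
  (forall y, C' y -> exists2 x, C x & B' (y - f x)) ->
  chain n B' C' -> chain n (fun x => C x /\ B' (f x)) (fun x => C x /\ C' (f x)).
Proof.
elim: n C' => [|n IH] D' sD' lift /=; first by move=> h x [? /h].
case=> D [sD DD' [y D'y nDy]] ch.
exists (fun x => C x /\ D (f x)); last by apply: IH => // z /DD' /lift.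
split; first exact: submod_preim.
  by move=> x [? /DD'].
have BD := chain_sub ch.
have [x Cx /BD Dyx] := lift y D'y; exists x.
  split=> //; rewrite -(subKr y (f x)); apply: submodB => //; exact: DD'.
by case=> _ Dfx; apply: nDy; rewrite -[y](subrK (f x)); apply: submodD.
Qed.

Lemma chain_im n : submod B' -> (forall x, C x -> B' (f x) -> B x) -> chain n B C ->
  chain n B' (fun y => exists2 x, C x & B' (y - f x)).
Proof.
move=> sB'; elim: n C sC => [|n IH] D sD inj /=.
  by move=> BD y B'y; exists 0; [apply: submod0|rewrite linear0 subr0].
case=> D' [sD' DD' [x Dx nDx]] ch.
exists (fun y => exists2 x, D' x & B' (y - f x)); last by apply: IH => // z /DD' /inj.
split.
- split=> [|y z [u Du yu] [v Dv zv]|a y sa [u Du yu]].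
  + by exists 0; [apply: submod0|rewrite linear0 subr0; apply: submod0].
  + exists (u - v); first exact: submodB.
    by rewrite linearB opprD addrACA -opprD; apply: submodB.
  + by exists (a *: u); [apply: submodZ|rewrite linearZ -scalerBr; apply: submodZ].
- by move=> y [z /DD' ? ?]; exists z.
exists (f x); first by exists x; rewrite ?subrr //; apply: submod0.
case=> z D'z B'xz; apply: nDx; rewrite -[x](subrK z).
apply: submodD => //; apply: (chain_sub ch); apply: inj; last by rewrite linearB.
by apply: submodB => //; apply: DD'.
Qed.

(* From here on f induces a surjection from C / B to C' / B'. *)
Hypotheses (sB : submod B) (sB' : submod B') (sC' : submod C').
Hypotheses (bBC : bounded B C) (BC : forall x, B x -> C x).
Hypotheses (BB' : forall x, B x -> B' (f x)).
Hypothesis lift : forall y, C' y -> exists2 x, C x & B' (y - f x).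

Let pull n : chain n B' C' -> chain n (fun x => C x /\ B' (f x)) C.
Proof. by move/(chain_preim sC' lift); apply: chain_weaken => // x []. Qed.

Lemma bounded_im : bounded B' C'.
Proof.
have [n nch] := bBC; exists n => /pull ch; apply: nch.
by apply: chain_weaken ch => // x Bx; split; [apply: BC|apply: BB'].
Qed.

Lemma len_im : (forall x, B' x -> C' x) -> (len B' C' <= len B C)%N.
Proof.
move=> BC'; apply: len_le => //.
have /pull := bounded_len bounded_im BC'.
by apply: chain_weaken => // x Bx; split; [apply: BC|apply: BB'].
Qed.

(** A nonzero kernel would add a step below the preimage of a chain of maximal
length. *)
Lemma len_im_inj : (forall x, B' x -> C' x) -> len B' C' = len B C ->
  forall x, C x -> B' (f x) -> B x.
Proof.
move=> BC' eql x Cx B'fx; apply: contrapT => nBx.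
suff /(len_le bBC) : chain (len B' C' + 1) B C by rewrite eql addn1 ltnn.
have /pull := bounded_len bounded_im BC'; apply: chain_cat.
  exact: submod_preim.
by apply: (@chain1 _ _ _ x) => // y By; split; [apply: BC|apply: BB'].
Qed.

Lemma len_iso : (forall x, B' x -> C' x) -> (forall x, C x -> C' (f x)) ->
  (forall x, C x -> B' (f x) -> B x) -> len B' C' = len B C.
Proof.
move=> BC' CC' inj; apply/eqP; rewrite eqn_leq len_im //=.
have := chain_im sB' inj (bounded_len bBC BC); move=> ch.
apply: len_le bounded_im _; apply: chain_weaken ch => // y [x Cx B'yx].
by rewrite -[y](subrK (f x)); apply: submodD => //; [apply: BC'|apply: CC'].
Qed.

End TwoModules.

Lemma len_eq0 (H : lmodType S) (B C : H -> Prop) :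
  bounded B C -> (forall x, B x -> C x) -> (forall x, C x -> B x) -> len B C = 0%N.
Proof.
move=> bd BC CB; have := bounded_len bd BC; case: (len _ _) => // n /=.
by case=> D [_ _ [x /CB Bx nDx]] /chain_sub /(_ x Bx).
Qed.

Lemma submod_prod (H1 H2 : lmodType S) (B1 : H1 -> Prop) (B2 : H2 -> Prop) :
  submod B1 -> submod B2 -> submod (fun x : H1 * H2 => B1 x.1 /\ B2 x.2).
Proof.
move=> s1 s2; split=> [|x y [x1 x2] [y1 y2]|a x sa [x1 x2]]; split.
- exact: (submod0 s1).
- exact: (submod0 s2).
- exact: (submodB s1 x1 y1).
- exact: (submodB s2 x2 y2).
- exact: (submodZ s1 sa x1).
- exact: (submodZ s2 sa x2).
Qed.

(** [C1 * B2] lies between the two products, and the two factors of the resulting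
filtration are isomorphic to [C1 / B1] and [C2 / B2]. *)
Lemma len_prod (H1 H2 : lmodType S) (B1 C1 : H1 -> Prop) (B2 C2 : H2 -> Prop) :
  submod B1 -> submod C1 -> submod B2 -> submod C2 ->
  (forall x, B1 x -> C1 x) -> (forall x, B2 x -> C2 x) ->
  bounded B1 C1 -> bounded B2 C2 ->
  let B (x : H1 * H2) := B1 x.1 /\ B2 x.2 in
  let C (x : H1 * H2) := C1 x.1 /\ C2 x.2 in
  bounded B C /\ len B C = (len B1 C1 + len B2 C2)%N.
Proof.
move=> sB1 sC1 sB2 sC2 BC1 BC2 b1 b2 B C.
pose D (x : H1 * H2) := C1 x.1 /\ B2 x.2.
have sB := submod_prod sB1 sB2; have sC := submod_prod sC1 sC2.
have sD := submod_prod sC1 sB2.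
pose inl : {linear H1 -> (H1 * H2)%type} :=
  lin_of (pair_linear idfun (\0 : {linear H1 -> H2})).
pose inr : {linear H2 -> (H1 * H2)%type} :=
  lin_of (pair_linear (\0 : {linear H2 -> H1}) idfun).
have z1 := submod0 sB1; have z2 := submod0 sB2.
have BD x : B x -> D x by case=> /BC1.
have DC x : D x -> C x by case=> ? /BC2.
have inlB x : B1 x -> B (inl x) by [].
have inrD y : B2 y -> D (inr y) by move=> ?; split=> //; apply: BC1.
have liftl x : D x -> exists2 y, C1 y & B (x - inl y).
  case: x => x y [/= C1x B2y]; exists x => //; split=> /=; first by rewrite subrr.
  by rewrite subr0.
have liftr x : C x -> exists2 y, C2 y & D (x - inr y).
  case: x => x y [/= C1x C2y]; exists y => //; split=> /=; first by rewrite subr0.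
  by rewrite subrr.
have bBD : bounded B D := bounded_im sC1 sD b1 BC1 inlB liftl.
have bDC : bounded D C := bounded_im sC2 sC b2 BC2 inrD liftr.
have [bBC ->] := bounded_cat sC sD BD DC bBD bDC; split=> //; congr addn.
  apply/eqP; rewrite eqn_leq (len_im sC1 sD b1 BC1 inlB liftl) //=.
  apply: (len_im (f := fst) sD sC1 bBD BD) => // [x []//|x C1x].
  by exists (x, 0) => //=; rewrite subrr.
apply/eqP; rewrite eqn_leq (len_im sC2 sC b2 BC2 inrD liftr) //=.
apply: (len_im (f := snd) sC sC2 bDC DC) => // [x []//|x C2x].
by exists (0, x); [split=> //; apply: BC1|rewrite /= subrr].
Qed.

End Chains.

(** * Artinian commutative rings *)

Section ArtinianFiniteLength.

Variable R : comPzRingType.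
Local Open Scope classical_set_scope.
Local Open Scope ring_scope.

Definition all_scalars (S : pzRingType) (_ : S) : Prop := True.

Notation ideal := (@submod R (@all_scalars R) R^o).
Notation finite_length := (bounded (@all_scalars R) (fun x : R^o => x = 0)).

Hypothesis artR : artinian R.

Lemma submod_ideal (I : R^o -> Prop) : ideal I -> is_ideal (I : R -> Prop).
Proof.
move=> sI; split; first exact: submod0 sI.
  by move=> x y; apply: (submodD sI).
by move=> a x Ix; apply: (submodZ (a := a) sI).
Qed.

(** A strictly decreasing sequence of ideals would result from dependent choice. *)
Lemma minimal_ideal (P : (R^o -> Prop) -> Prop) I0 : ideal I0 -> P I0 ->
  exists I, [/\ ideal I, P I &
    forall J, ideal J -> P J -> (forall x, J x -> I x) -> forall x, I x -> J x].
Proof.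
move=> iI0 PI0; apply: contrapT => /forallNP nomin.
pose T := {I : R^o -> Prop | ideal I /\ P I}.
have step (I : T) : exists J : T,
    (forall x, sval J x -> sval I x) /\ exists2 x, sval I x & ~ sval J x.
  case: I => I [iI PI] /=; apply: contrapT => noJ; apply: (nomin I); split=> //.
  move=> J iJ PJ JI x Ix; apply: contrapT => nJx; apply: noJ.
  by exists (exist _ J (conj iJ PJ)); split=> //; exists x.
have [next nextP] := choice step.
pose T0 : T := exist _ I0 (conj iI0 PI0); pose I n := sval (iter n next T0).
have [||N stab] := artR (I := I).
- by move=> n; apply: submod_ideal; rewrite /I; case: (iter _ _ _) => J [].
- by move=> n x; exact: (nextP (iter n next T0)).1.
have [_ [x Ix nIx]] := nextP (iter N next T0).
by apply: nIx; apply/(stab N.+1).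
Qed.

Lemma bounded_zero (I : R^o -> Prop) : (forall x, I x -> x = 0) -> finite_length I.
Proof.
move=> I0; exists 0%N => -[C' [sC' _ [x /I0-> h]] _].
by apply: h; apply: submod0 sC'.
Qed.

Section MinimalInfinite.

Variable I : R^o -> Prop.
Hypotheses (iI : ideal I) (infI : ~ finite_length I).
Hypothesis minI : forall J, ideal J -> (forall x, J x -> I x) ->
  (exists2 x, I x & ~ J x) -> finite_length J.

Let mulrP (r : R) : linear (fun x : R^o => r * x : R^o).
Proof. by move=> a x y; rewrite mulrDr /GRing.scale /= mulrCA. Qed.

(** If neither alternative holds, the kernel and the image of the multiplication
by [r] are proper submodules of [I], hence of finite length, and so is [I]. *)
Lemma kill_or_onto (r : R) :
  (forall x, I x -> r * x = 0) \/ (forall y, I y -> exists2 x, I x & r * x = y).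
Proof.
apply: contrapT => /not_orP[/existsNP[x0 /not_implyP[Ix0 rx0]] nonto].
apply: infI; pose K (x : R^o) := I x /\ r * x = 0.
have iK : ideal K := submod_preim (lin_of (@mulrP r)) iI (submod_zero _ _).
have KI x : K x -> I x by case.
have flK : finite_length K by apply: minI => //; exists x0 => // -[].
have [] := bounded_cat (B := fun x : R^o => x = 0) iI iK _ KI flK _ => //.
  by move=> _ ->; apply: submod0 iK.
have [|||n nch] := minI (J := fun y : R^o => exists2 x, I x & r * x = y).
- exact: (submod_im (lin_of (@mulrP r)) iI).
- by move=> _ [x Ix <-]; apply: (submodZ (a := r) iI).
- by move/existsNP: nonto => [y /not_implyP[Iy ny]]; exists y.
exists n => ch; apply: nch.
apply: chain_weaken (chain_im (f := lin_of (@mulrP r)) iI (submod_zero _ _) _ ch) => //.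
by move=> y [x Ix /subr0_eq->]; exists x.
Qed.

Lemma minimal_infinite_absurd : False.
Proof.
have [x [Ix nx0]] : exists x, I x /\ x <> 0.
  apply: contrapT => /forallNP h; apply: infI; apply: bounded_zero => x Ix.
  by apply: contrapT => nx; apply: (h x).
(* R modulo the annihilator of I is a field: if r acts surjectively then so do
its powers, and the ideals generated by these powers stabilize *)
have inv r : (forall y, I y -> exists2 z, I z & r * z = y) ->
    exists s, forall y, I y -> y = r * s * y.
  move=> onto.
  have onton n y : I y -> exists2 z, I z & r ^+ n * z = y.
    elim: n y => [|n IH] y Iy; first by exists y; rewrite ?mul1r.
    have [z Iz <-] := onto y Iy; have [w Iw <-] := IH z Iz.
    by exists w; rewrite // exprS mulrA.
  have [||N stab] := artR (I := fun n (y : R) => exists s, y = r ^+ n * s).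
  - move=> n; split; first by exists 0; rewrite mulr0.
      by move=> _ _ [s ->] [s' ->]; exists (s + s'); rewrite mulrDr.
    by move=> a _ [s ->]; exists (a * s); rewrite mulrCA.
  - by move=> n _ [s ->]; exists (r * s); rewrite exprSr mulrA.
  have [s eqs] : exists s, r ^+ N = r ^+ N.+1 * s.
    by apply/(stab N.+1) => //; exists 1; rewrite mulr1.
  exists s; case: (kill_or_onto (1 - r * s)) => [h y Iy|h].
    by apply/subr0_eq; rewrite -{1}[y]mul1r -mulrBl h.
  case: nx0; have [y Iy <-] := onton N x Ix; have [z _ <-] := h y Iy.
  by rewrite mulrA mulrBr mulr1 mulrA -exprSr -eqs subrr mul0r.
(* Zorn's lemma gives a hyperplane A, as a maximal submodule avoiding x; the
predicate P does not mention 0 so that it is inherited by the empty union *)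
pose P (A : set R) := [/\ forall y z, A y -> A z -> A (y - z),
  forall a y, A y -> A (a * y), A `<=` I & ~ A x].
have [F FP tot|A [[AB AM AI nAx] maxA]] := @Zorn_bigcup R P.
  split.
  - move=> y z [B FB By] [C FC Cz]; case: (tot _ _ FB FC) => h.
      by exists C => //; case: (FP _ FC) => + _ _ _; apply=> //; apply: h.
    by exists B => //; case: (FP _ FB) => + _ _ _; apply=> //; apply: h.
  - by move=> a y [B FB By]; exists B => //; case: (FP _ FB) => _ + _ _; apply.
  - by move=> y [B FB By]; case: (FP _ FB) => _ _ + _; apply.
  - by case=> B FB Bx; case: (FP _ FB) => _ _ _; apply.
have A0 : A 0.
  apply: contrapT => nA0; apply: (maxA [set 0]).
    split=> [y Ay|h]; last by apply: nA0; apply: h.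
    by case: nA0; rewrite -(subrr y); apply: AB.
  split=> [y z -> ->|a y ->|y ->|]; rewrite /= ?subrr ?mulr0 //.
  exact: submod0 iI.
have iA : ideal A by split=> // a y _; apply: AM.
have flA : finite_length A by apply: minI => //; exists x.
(* I / A is simple *)
have above C y : ideal C -> (forall z, A z -> C z) -> C y -> I y -> ~ A y ->
    forall z, I z -> C z.
  move=> iC AC Cy Iy nAy.
  have key w : I w -> ~ A w -> exists a r, A a /\ x = a + r * w.
    move=> Iw nAw; apply: contrapT => no.
    apply: (maxA [set z | exists a r, A a /\ z = a + r * w]).
      split=> [z Az|h]; first by exists z, 0; rewrite mul0r addr0.
      by apply: nAw; apply: h; exists 0, 1; rewrite mul1r add0r.
    split=> //.
    - move=> _ _ [a [r [Aa ->]]] [a' [r' [Aa' ->]]]; exists (a - a'), (r - r').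
      by split; [apply: AB|rewrite mulrBl opprD addrACA].
    - move=> b _ [a [r [Aa ->]]]; exists (b * a), (b * r).
      by split; [apply: AM|rewrite mulrDr mulrA].
    - move=> _ [a [r [Aa ->]]]; apply: (submodD iI); first exact: AI.
      exact: (submodZ (a := r) iI).
  have Cx : C x.
    have [a [r [Aa ->]]] := key y Iy nAy; apply: (submodD iC); first exact: AC.
    exact: (submodZ (a := r) iC).
  move=> z Iz; case: (pselect (A z)) => [/AC //|nAz].
  have [a [r [Aa ex]]] := key z Iz nAz.
  case: (kill_or_onto r) => [kz|/inv[s hs]].
    by case: nAx; rewrite ex kz // addr0.
  have -> : z = s * (x - a) by rewrite ex addrC addKr mulrA [s * r]mulrC -hs.
  by apply: (submodZ (a := s) iC) => //; apply: (submodB iC) => //; apply: AC.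
apply: infI; have [] := bounded_cat (B := fun y : R^o => y = 0) iI iA _ AI flA _ => //.
  by move=> _ ->.
exists 1%N => -[C1 [iC1 C1I [y Iy nC1y]]] [C2 [iC2 C21 [z C1z nC2z]] AC2].
apply: nC1y; apply: (above C1 z) => //; first by move=> w /AC2 /C21.
  exact: C1I.
by move/AC2.
Qed.

End MinimalInfinite.

(** An ideal [I] minimal among those of infinite length would be killed or mapped
onto itself by each scalar, hence would be a vector space over a residue field
of [R]. A hyperplane of [I] is of finite length by minimality, and then [I] has
finite length too. *)
Theorem artinian_finite_length : finite_length (fun _ => True).
Proof.
apply: contrapT => inf.
have [//|I [iI infI minI]] :=
  @minimal_ideal (fun I => ~ finite_length I) (fun _ => True) (submod_full _ _).
apply: (minimal_infinite_absurd iI infI) => J iJ JI [x Ix nJx].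
by apply: contrapT => infJ; apply: nJx; apply: minI.
Qed.

End ArtinianFiniteLength.

(** * Submodules, retracts and projective modules *)

Section LinearAlgebra.

Variable A : pzRingType.
Implicit Types M N U V W X Y Z F : lmodType A.

Section Subobject.

Variables (U : lmodType A) (B : U -> Prop) (sB : submod (@all_scalars A) B).

(** The proof [sB] is a parameter of the type, so that unification finds the
module structure. *)
Definition submod_type : Type := (fun _ : submod (@all_scalars A) B => {x : U | `[< B x >]}) sB.

Let in_B : pred U := fun x => `[< B x >].

HB.instance Definition _ := SubChoice.copy submod_type {x : U | `[< B x >]}.

Fact submod_type_closed : subsemimod_closed in_B.
Proof.
split; first split.
- exact/asboolP/(submod0 sB).
- by move=> x y /asboolP Bx /asboolP By; apply/asboolP/(submodD sB).
- by move=> a x /asboolP Bx; apply/asboolP/(submodZ (a := a) sB).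
Qed.

HB.instance Definition _ :=
  @GRing.SubChoice_isSubLmodule.Build A U in_B submod_type submod_type_closed.

End Subobject.

(** Kernels and images enter the constructions below as abstract modules with an
embedding. *)
Lemma submod_embedding U (B : U -> Prop) : submod (@all_scalars A) B ->
  exists (K : lmodType A) (i : {linear K -> U}),
    injective i /\ forall x, B x <-> exists z, i z = x.
Proof.
move=> sB; exists (submod_type sB), (val : {linear submod_type sB -> U}).
split; first exact: val_inj.
move=> x; split=> [/asboolP Bx|[z <-]]; last exact/asboolP/(valP z).
by exists (exist _ x Bx).
Qed.

Lemma factor_inj X Z F (i : {linear Z -> F}) (h : {linear X -> F}) :
  injective i -> (forall x, exists z, i z = h x) ->
  exists h' : {linear X -> Z}, forall x, i (h' x) = h x.
Proof.
move=> inj_i /choice[k kP].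
have linP : linear k.
  by move=> a x y; apply: inj_i; rewrite linearP !kP linearP.
by exists (lin_of linP).
Qed.

Lemma factor_surj X Z F (p : {linear F -> Z}) (h : {linear F -> X}) :
  surjective p -> (forall x, p x = 0 -> h x = 0) ->
  exists h' : {linear Z -> X}, forall x, h' (p x) = h x.
Proof.
move=> /choice[k kP] hp0.
have hk x : h (k (p x)) = h x.
  by apply/subr0_eq; rewrite -linearB hp0 // linearB kP subrr.
have linP : linear (h \o k).
  by move=> a x y /=; rewrite -[RHS]linearP -[RHS]hk linearP !kP.
by exists (lin_of linP).
Qed.

Lemma bij_inverse U V (f : {linear U -> V}) : bijective f ->
  exists g : {linear V -> U}, cancel f g /\ cancel g f.
Proof.
case=> g fK gK; have linP : linear g.
  by move=> a x y; apply: (can_inj fK); rewrite linearP !gK.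
by exists (lin_of linP).
Qed.

Lemma isomorphic_refl U : isomorphic U U.
Proof. by exists idfun; exists idfun. Qed.

Lemma isomorphic_sym U V : isomorphic U V -> isomorphic V U.
Proof. by case=> f /bij_inverse[g [fK gK]]; exists g; exists f. Qed.

Lemma isomorphic_trans U V W : isomorphic U V -> isomorphic V W -> isomorphic U W.
Proof. by move=> [f bf] [g bg]; exists (g \o f); apply: bij_comp. Qed.

Lemma combination_linear N k (g : 'I_k -> N) :
  linear (fun c : {ffun 'I_k -> A^o} => \sum_(j < k) (c j : A) *: g j).
Proof.
move=> a c d; rewrite scaler_sumr -big_split /=; apply: eq_bigr => j _.
by rewrite !ffunE scalerDl scalerA.
Qed.

Lemma fg_cover N : finitely_generated N ->
  exists k (p : {linear {ffun 'I_k -> A^o} -> N}), surjective p.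
Proof.
case=> k [g gP]; exists k, (lin_of (combination_linear g)) => y.
have [c ->] := gP y; exists [ffun j => c j] => /=.
by apply: eq_bigr => j _; rewrite ffunE.
Qed.

Lemma fg_finType (T : finType) N (g : T -> N) :
  (forall x, exists c : T -> A, x = \sum_t c t *: g t) -> finitely_generated N.
Proof.
move=> gP; exists #|T|, (g \o enum_val) => x; have [c ->] := gP x.
exists (c \o enum_val); rewrite (reindex (@enum_val T predT)) //=.
by apply: onW_bij; apply: enum_val_bij.
Qed.

Lemma fg_ffun N k : finitely_generated N -> finitely_generated {ffun 'I_k -> N}.
Proof.
case=> m [g gP].
apply: (@fg_finType ('I_k * 'I_m)%type _
  (fun t => [ffun i => if i == t.1 then g t.2 else 0])) => v.
have /choice[c cP] i := gP (v i).
exists (fun t => c t.1 t.2); apply/ffunP => i; rewrite sum_ffunE.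
rewrite -(pair_big predT predT (fun i' j => (c i' j *: [ffun i0 => if i0 == i' then g j else 0]) i)) /=.
rewrite (bigD1 i) //= [X in _ + X]big1 ?addr0 => [|i' ne_i'].
  by rewrite cP; apply: eq_bigr => j _; rewrite !ffunE eqxx.
by apply: big1 => j _; rewrite !ffunE eq_sym (negPf ne_i') scaler0.
Qed.

Lemma fg_regular : finitely_generated A^o.
Proof.
exists 1%N, (fun=> 1) => x; exists (fun=> x).
by rewrite big_ord1; apply/esym/mulr1.
Qed.

Lemma fg_surj U V (p : {linear U -> V}) : surjective p ->
  finitely_generated U -> finitely_generated V.
Proof.
move=> ps [k [g gP]]; exists k, (p \o g) => y; have [x <-] := ps y.
have [c ->] := gP x; exists c; rewrite linear_sum.
by apply: eq_bigr => j _; rewrite linearZ.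
Qed.

Lemma fg_iso U V : isomorphic U V -> finitely_generated U -> finitely_generated V.
Proof. by case=> f [g fK gK]; apply: fg_surj => y; exists (g y). Qed.

(** Equivalent to [direct_summand], but closed under composition at once. *)
Definition retract U V : Prop :=
  exists (a : {linear U -> V}) (b : {linear V -> U}), cancel a b.

Lemma retract_trans U V W : retract U V -> retract V W -> retract U W.
Proof.
move=> [a [b ab]] [c [d cd]]; exists (c \o a), (b \o d) => x /=.
by rewrite cd ab.
Qed.

Lemma retract_iso U V : isomorphic U V -> retract U V.
Proof. by case=> f /bij_inverse[g [fK _]]; exists f, g. Qed.

Lemma retract_fst U V : retract U (U * V)%type.
Proof.
exists (lin_of (pair_linear idfun (\0 : {linear U -> V}))), fst.
by move=> x.
Qed.

Lemma retract_snd U V : retract V (U * V)%type.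
Proof.
exists (lin_of (pair_linear (\0 : {linear V -> U}) idfun)), snd.
by move=> x.
Qed.

Lemma retract_summand U V : direct_summand U V -> retract U V.
Proof. by case=> W /retract_iso; apply: retract_trans; apply: retract_fst. Qed.

Lemma kernel_submod U V (f : {linear U -> V}) (sc : A -> Prop) :
  submod sc (fun x => f x = 0).
Proof.
split=> [|x y fx fy|a x _ fx]; first exact: linear0.
  by rewrite linearB fx fy subrr.
by rewrite linearZ /= fx scaler0.
Qed.

Lemma image_submod U V (f : {linear U -> V}) (sc : A -> Prop) :
  submod sc (fun y => exists x, f x = y).
Proof.
split=> [|_ _ [x <-] [y <-]|a _ _ [x <-]]; first by exists 0; rewrite linear0.
  by exists (x - y); rewrite linearB.
by exists (a *: x); rewrite linearZ.
Qed.

Lemma internal_sum_iso U V W (i : {linear U -> W}) (j : {linear V -> W}) :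
  (forall x y, i x = j y -> x = 0 /\ y = 0) ->
  (forall z, exists x y, z = i x + j y) -> isomorphic (U * V)%type W.
Proof.
move=> dir tot.
have linP : linear (fun u : U * V => i u.1 + j u.2).
  by move=> a u v; rewrite !linearP /= scalerDr addrACA.
exists (lin_of linP); have inj : injective (lin_of linP).
  move=> [x y] [x' y'] /= /eqP; rewrite -subr_eq0 opprD addrACA -!linearB.
  rewrite addr_eq0 -linearN => /eqP /dir[/subr0_eq-> /eqP].
  by rewrite oppr_eq0 subr_eq0 => /eqP->.
have /choice[k kP] z : exists u, lin_of linP u = z.
  by have [x [y ->]] := tot z; exists (x, y).
by exists k => // u; apply: inj.
Qed.

(** The complement is the kernel of the retraction. *)
Lemma summand_retract U V : retract U V -> direct_summand U V.
Proof.
case=> a [b ab]; have [W [i [inj_i iP]]] := submod_embedding (kernel_submod b _).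
exists W; apply: (internal_sum_iso (i := a) (j := i)) => [x y e|z].
  have bi0 : b (i y) = 0 by apply/iP; exists y.
  have x0 : x = 0 by rewrite -[x]ab e.
  split=> //; apply: inj_i; rewrite -e x0 !linear0 //.
have [w we] : exists w, i w = z - a (b z).
  by apply/iP; rewrite linearB /= ab subrr.
by exists (b z), w; rewrite we addrC subrK.
Qed.

Lemma fg_retract U V : retract U V -> finitely_generated V -> finitely_generated U.
Proof. by case=> a [b ab]; apply: (fg_surj (p := b)) => x; exists (a x). Qed.

Lemma projective_retract U V : retract U V -> projective V -> projective U.
Proof.
move=> [a [b ab]] pV X Y g f gs; have [h hP] := pV X Y g (f \o b) gs.
by exists (h \o a) => x; rewrite /= hP /= ab.
Qed.

Lemma projective_prod U V : projective U -> projective V -> projective (U * V)%type.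
Proof.
move=> pU pV X Y g f gs.
have [h hP] := pU X Y g (f \o lin_of (pair_linear idfun (\0 : {linear U -> V}))) gs.
have [k kP] := pV X Y g (f \o lin_of (pair_linear (\0 : {linear V -> U}) idfun)) gs.
exists ((h \o fst) \+ (k \o snd)) => -[x y] /=; rewrite linearD hP kP /= -linearD.
by congr (f _); congr (_, _); rewrite /= ?addr0 ?add0r.
Qed.

Lemma projective_free k : projective {ffun 'I_k -> A^o}.
Proof.
move=> X Y g f gs.
pose e (j : 'I_k) : {ffun 'I_k -> A^o} := [ffun i => (i == j)%:R].
have /choice[x xP] j := gs (f (e j)).
exists (lin_of (combination_linear x)) => c /=; rewrite linear_sum.
have ec : c = \sum_(j < k) (c j : A) *: e j.
  apply/ffunP => i; rewrite sum_ffunE (bigD1 i) //= big1 => [|j ne_ji].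
    by rewrite !ffunE eqxx addr0 /GRing.scale /= mulr1.
  by rewrite !ffunE eq_sym (negPf ne_ji) scaler0.
rewrite [in RHS]ec linear_sum; apply: eq_bigr => j _.
by rewrite !linearZ /= xP.
Qed.

Lemma projective_zero U : zero_module U -> projective U.
Proof.
move=> U0 X Y g f _; exists \0 => x /=; by rewrite linear0 (U0 x) linear0.
Qed.

Lemma fg_projective_free U : finitely_generated U -> projective U ->
  exists k, retract U {ffun 'I_k -> A^o}.
Proof.
move=> /fg_cover[k [p ps]] pU; exists k.
have [h hP] := pU _ _ p idfun ps.
by exists h, p => x; rewrite hP.
Qed.

(** A free cover of [X] lifts to [U], and the lift is surjective because the
projective cover is essential. *)
Lemma projective_cover_fg U X (p : {linear U -> X}) : projective_cover p ->
  finitely_generated X -> finitely_generated U.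
Proof.
case=> pU ps ess /fg_cover[k [q qs]].
have [h hP] := @projective_free k _ _ p q ps.
apply: (fg_surj (p := h)); last exact/fg_ffun/fg_regular.
by apply: ess => x; have [c <-] := qs x; exists c => /=; rewrite hP.
Qed.

(** * Stable homomorphisms *)

(** The zero morphisms of the stable category. *)
Definition stably_zero X Y (f : {linear X -> Y}) : Prop :=
  exists (P : lmodType A) (u : {linear X -> P}) (v : {linear P -> Y}),
    projective P /\ forall x, v (u x) = f x.

Lemma stably_zero_comp X' X Y Y' (f : {linear X -> Y}) (g : {linear X' -> X})
    (h : {linear Y -> Y'}) (k : {linear X' -> Y'}) :
  stably_zero f -> (forall x, k x = h (f (g x))) -> stably_zero k.
Proof.
move=> [P [u [v [pP uv]]]] kP; exists P, (u \o g), (h \o v); split=> // x /=.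
by rewrite uv kP.
Qed.

Lemma stably_zeroD X Y (f g k : {linear X -> Y}) :
  stably_zero f -> stably_zero g -> (forall x, k x = f x + g x) -> stably_zero k.
Proof.
move=> [P [u [v [pP uv]]]] [P' [u' [v' [pP' uv']]]] kP.
exists (P * P')%type, (lin_of (pair_linear u u')), ((v \o fst) \+ (v' \o snd)).
by split=> [|x]; [apply: projective_prod|rewrite /= uv uv' kP].
Qed.

Lemma stably_zero_id X : stably_zero (idfun : {linear X -> X}) -> projective X.
Proof. by case=> P [u [v [pP uv]]]; apply: projective_retract pP; exists u, v. Qed.

End LinearAlgebra.

(** * Modules of finite length over an Artin algebra *)

Section ArtinAlgebra.

Variables (R : comPzRingType) (A : algType R).
Implicit Types K M N U V W X Y Z F : lmodType A.

Definition base_scalar (a : A) : Prop := exists r : R, a = r%:A.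

Hypothesis hA : artin_algebra A.

(** Modulo [D], the module [C] is generated over [R] by [y], so it is a quotient
of [R] and chains can be pulled back to ideals. *)
Lemma chain_scalars n N (D C : N -> Prop) (y : N) :
  submod base_scalar C ->
  (forall z, C z -> exists r : R, D (z - r%:A *: y)) ->
  chain base_scalar n D C ->
  chain (@all_scalars R) n (fun r : R^o => D (r%:A *: y)) (fun r : R^o => C (r%:A *: y)).
Proof.
elim: n C => [|n IH] C sC lift /=; first by move=> h r /h.
case=> C' [sC' C'C [z Cz nC'z]] ch.
exists (fun r : R^o => C' (r%:A *: y)); last by apply: IH => // w /C'C /lift.
split.
- split=> [|r s C'r C's|r s _ C's]; first by rewrite scale0r scale0r; apply: (submod0 sC').
    by rewrite !scalerBl; apply: (submodB sC').
  have -> : (r *: s)%:A *: y = r%:A *: (s%:A *: y).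
    by rewrite scalerA mulr_algl scalerA.
  by apply: (submodZ sC'); first by exists r.
- by move=> r /C'C.
- have [r Dzr] := lift z Cz; have C'zr := chain_sub ch Dzr; exists r.
    by rewrite -(subKr z (r%:A *: y)); apply: (submodB sC Cz); apply: C'C.
  by move=> C'r; apply: nC'z; rewrite -[z](subrK (r%:A *: y)); apply: (submodD sC').
Qed.

Fixpoint base_span N (s : seq N) (x : N) : Prop :=
  if s is y :: s' then exists r : R, base_span s' (x - r%:A *: y) else x = 0.

Lemma base_span_submod N (s : seq N) : submod base_scalar (base_span s).
Proof.
elim: s => [|y s IH] /=; first exact: submod_zero.
split=> [|x z [r xr] [r' zr']|_ x [r' ->] [r xr]].
- by exists 0; rewrite !scale0r subr0; apply: (submod0 IH).
- exists (r - r'); rewrite !scalerBl opprD addrACA -opprD.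
  exact: (submodB IH xr zr').
- exists (r' * r); have -> : (r' * r)%:A *: y = r'%:A *: (r%:A *: y).
    by rewrite scalerA mulr_algl scalerA.
  by rewrite -scalerBr; apply: (submodZ IH); first by exists r'.
Qed.

Lemma mem_base_span N (s : seq N) x : x \in s -> base_span s x.
Proof.
elim: s => // y s IH; rewrite inE => /orP[/eqP->|/IH h] /=.
  by exists 1; rewrite !scale1r subrr; apply: (submod0 (base_span_submod s)).
by exists 0; rewrite !scale0r subr0.
Qed.

Lemma base_span_bounded N (s : seq N) :
  bounded base_scalar (fun x => x = 0) (base_span s).
Proof.
elim: s => [|y s IH] /=.
  by exists 0%N => -[C' [sC' _ [x -> h]] _]; apply: h; apply: (submod0 sC').
have sD := base_span_submod s; have sC := base_span_submod (y :: s).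
apply: (proj1 (bounded_cat sC sD _ _ IH _)).
- by move=> _ ->; apply: (submod0 sD).
- by move=> x Dx; exists 0; rewrite !scale0r subr0.
have [n nch] := artinian_finite_length hA.1; exists n => /(chain_scalars (y := y) sC).
move=> h; apply: nch; apply: chain_weaken (h _) => //= r ->.
by rewrite !scale0r; apply: (submod0 sD).
Qed.

Definition finite_length N := bounded base_scalar (fun x : N => x = 0) (fun _ => True).

Lemma fg_finite_length N : finitely_generated N -> finite_length N.
Proof.
case=> k [g gP]; have [m [u uP]] := hA.2.
pose s := [seq u p.2 *: g p.1 | p : 'I_k * 'I_m].
apply: bounded_weaken (base_span_bounded s) => // x _.
have [c ->] := gP x; apply: submod_sum (base_span_submod s) _ => i.
have [r ->] := uP (c i); rewrite scaler_suml.
apply: submod_sum (base_span_submod s) _ => j.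
have -> : (r j *: u j) *: g i = (r j)%:A *: (u j *: g i).
  by rewrite scalerA mulr_algl.
apply: (submodZ (base_span_submod s) _ _); first by exists (r j).
by apply: mem_base_span; apply/mapP; exists (i, j); rewrite ?mem_enum.
Qed.

Lemma submod_base N (B : N -> Prop) : submod (@all_scalars A) B -> submod base_scalar B.
Proof.
by move=> sB; split=> [|x y|a x _];
  [exact: (submod0 sB)|exact: (submodB sB)|exact: (submodZ (a := a) sB)].
Qed.

Definition span N k (g : 'I_k -> N) (x : N) : Prop :=
  exists c : 'I_k -> A, x = \sum_(j < k) c j *: g j.

Lemma span_submod N k (g : 'I_k -> N) : submod (@all_scalars A) (span g).
Proof.
split=> [|_ _ [c ->] [d ->]|a _ _ [c ->]].
- by exists (fun=> 0); rewrite big1 // => j _; rewrite scale0r.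
- exists (fun j => c j - d j); rewrite -sumrB.
  by apply: eq_bigr => j _; rewrite scalerBl.
- by exists (fun j => a * c j); rewrite scaler_sumr; apply: eq_bigr => j _; rewrite scalerA.
Qed.

Lemma span_add N k (g : 'I_k -> N) x : exists g' : 'I_k.+1 -> N,
  span g' x /\ forall y, span g y -> span g' y.
Proof.
exists (fun j => oapp g x (unlift ord0 j)); split.
  exists (fun j => (j == ord0)%:R); rewrite big_ord_recl /= unlift_none scale1r.
  by rewrite big1 ?addr0 // => j _; rewrite scale0r.
move=> _ [c ->]; exists (fun j => oapp c 0 (unlift ord0 j)).
rewrite big_ord_recl /= unlift_none /= scale0r add0r.
by apply: eq_bigr => j _; rewrite !liftK.
Qed.

(** Adding generators one by one gives longer and longer chains of finitely
generated submodules. *)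
Lemma finite_length_fg N : finite_length N -> finitely_generated N.
Proof.
case=> n nch; apply: contrapT => nfg; apply: nch.
have [k [g]] : exists k (g : 'I_k -> N),
    chain base_scalar n.+1 (fun x => x = 0) (span g); last by apply: chain_weaken.
elim: n.+1 => [|m [k [g ch]]].
  exists 0%N, (fun=> 0) => _ ->; exact: (submod0 (span_submod _)).
have [x nx] : exists x, ~ span g x.
  by apply/existsNP => h; apply: nfg; exists k, g.
have [g' [g'x sub]] := span_add g x; exists k.+1, g', (span g) => //.
by split=> //; [apply/submod_base/span_submod|exists x].
Qed.

Lemma fg_sub N K (i : {linear K -> N}) : injective i ->
  finitely_generated N -> finitely_generated K.
Proof.
move=> inj_i /fg_finite_length[n nch]; apply: finite_length_fg; exists n => ch.
apply: nch; have := chain_im (f := i) (submod_full _ _) (submod_zero _ _) _ ch.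
move=> /(_ (fun x _ ix => inj_i x 0 (etrans ix (esym (linear0 i))))).
exact: chain_weaken.
Qed.

Lemma fg_prod U V : finitely_generated U -> finitely_generated V ->
  finitely_generated (U * V)%type.
Proof.
move=> /fg_finite_length flU /fg_finite_length flV; apply: finite_length_fg.
have sz N := submod_zero base_scalar N; have sf N := submod_full base_scalar N.
have [+ _] := len_prod (sz U) (sf U) (sz V) (sf V) (fun _ _ => I) (fun _ _ => I) flU flV.
by apply: bounded_weaken => // -[x y] [/= -> ->].
Qed.

Definition module_length N : nat := len base_scalar (fun x : N => x = 0) (fun _ => True).

Lemma module_length_iso U V : finitely_generated U -> isomorphic U V ->
  module_length U = module_length V.
Proof.
move=> fgU isoUV; have fgV := fg_iso isoUV fgU.
have le U' V' : finitely_generated U' -> isomorphic U' V' ->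
    (module_length V' <= module_length U')%N.
  move=> fgU' [f [g fK gK]]; apply: (len_im (f := f)) => //.
  - exact: fg_finite_length.
  - by move=> _ ->; rewrite linear0.
  - by move=> y _; exists (g y); rewrite ?gK ?subrr.
by apply/eqP; rewrite eqn_leq !le //; apply: isomorphic_sym.
Qed.

Lemma module_length_prod U V : finitely_generated U -> finitely_generated V ->
  module_length (U * V)%type = (module_length U + module_length V)%N.
Proof.
move=> /fg_finite_length flU /fg_finite_length flV.
have sz N := submod_zero base_scalar N; have sf N := submod_full base_scalar N.
have [_] := len_prod (sz U) (sf U) (sz V) (sf V) (fun _ _ => I) (fun _ _ => I) flU flV.
move<-; congr len; first by apply/funext => -[x y]; apply/propext; split=> [[-> ->]|[/= -> ->]].
by apply/funext => -[x y]; apply/propext; split.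
Qed.

Lemma module_length_gt0 U : finitely_generated U -> ~ zero_module U -> (0 < module_length U)%N.
Proof.
move=> /fg_finite_length flU /existsNP[x nx]; apply: len_le => //.
by apply: (@chain1 _ _ _ _ _ x) => //; apply: submod_zero.
Qed.

(** The image of a chain of maximal length could be extended by one step on top
if the image of [f] were proper. *)
Lemma inj_endo_surj U (f : {linear U -> U}) : finitely_generated U ->
  injective f -> surjective f.
Proof.
move=> /fg_finite_length flU inj_f; apply: contrapT => /existsNP[y ny].
have ch := bounded_len flU (fun _ _ => I).
have := chain_im (f := f) (submod_full _ _) (submod_zero _ _) _ ch.
move=> /(_ (fun x _ fx => inj_f x 0 (etrans fx (esym (linear0 f))))) ch'.
suff : (module_length U < module_length U)%N by rewrite ltnn.
apply: len_le flU _; exists (fun z => exists2 x, True & f x = z).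
  split=> //; first exact: submod_im (submod_full _ _).
  by exists y => // -[x _ e]; apply: ny; exists x.
by apply: chain_weaken ch' => // z [x _ /subr0_eq->]; exists x.
Qed.

(** * Fitting's lemma *)

Lemma iter_linear U (f : {linear U -> U}) n : linear (iter n f).
Proof. by elim: n => [|n IH] a x y //=; rewrite IH linearP. Qed.

(** Fitting's lemma. The kernels and the images of the iterates of [f] become
stationary, and [U] is then the direct sum of the two stationary values. *)
Lemma fitting U (f : {linear U -> U}) : finitely_generated U -> indecomposable U ->
  bijective f \/ exists m, forall x, iter m f x = 0.
Proof.
move=> fgU [_ indU]; have flU := fg_finite_length fgU.
pose g n := lin_of (iter_linear f n).
have [a ka] : exists a, forall x, g a.+1 x = 0 -> g a x = 0.
  apply: (ascending_stop (B := fun n x => g n x = 0) _ _ _ _ flU) => //.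
  - by move=> n; apply: kernel_submod.
  - by move=> n x /= ->; rewrite linear0.
have [b ib] : exists b, forall x, (exists y, g b y = x) -> exists y, g b.+1 y = x.
  apply: (descending_stop (B := fun n x => exists y, g n y = x) _ _ _ _ flU) => //.
  - by move=> n; apply: image_submod.
  - by move=> n x [y <-]; exists (f y); rewrite /= -iterSr.
  - by move=> n _ ->; exists 0; rewrite linear0.
have kad d x : g (d + a)%N x = 0 -> g a x = 0.
  elim: d x => [|d IH] x //; rewrite addSn => e; apply: ka => /=; rewrite -iterS iterSr.
  by apply: IH; rewrite /= -iterSr.
have ibd d x : exists y, g (d + b)%N y = g b x.
  elim: d x => [|d IH] x; first by exists x.
  have [|y <-] := ib (g b x); first by exists x.
  by have [z e] := IH y; exists z; apply: (congr1 f e).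
(* any iterate beyond both stationary points will do *)
pose m := (a + b)%N.
have kill x : g m (g m x) = 0 -> g m x = 0.
  rewrite /= -iterD => e; rewrite /m addnC iterD.
  suff -> : iter a f x = 0 by apply: (linear0 (g b)).
  by apply: (kad (m + b)%N); rewrite /= -addnA [(b + a)%N]addnC.
have hit x : exists y, g m x = g m (g m y).
  have [y e] := ibd m x; exists y.
  rewrite /= {1}/m iterD -[iter b f x]e /= -!iterD.
  by congr (iter _ f y); rewrite /m; lia.
have [K [i [inj_i iP]]] := submod_embedding (kernel_submod (g m) _).
have [J [j [inj_j jP]]] := submod_embedding (image_submod (g m) _).
have iso : isomorphic (K * J)%type U.
  apply: (internal_sum_iso (i := i) (j := j)) => [x y e|z].
    have ix : g m (i x) = 0 by apply/iP; exists x.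
    have [z jy] : exists z, g m z = j y by apply/jP; exists y.
    have jy0 : j y = 0 by rewrite -jy; apply: kill; rewrite jy -e ix.
    by split; [apply: inj_i; rewrite e jy0 linear0|apply: inj_j; rewrite jy0 linear0].
  have [y e] := hit z.
  have [x ix] : exists x, i x = z - g m y by apply/iP; rewrite linearB e subrr.
  have [w jw] : exists w, j w = g m y by apply/jP; exists y.
  by exists x, w; rewrite ix jw subrK.
case: (indU _ _ iso) => [K0|J0]; last first.
  right; exists m => x; have /jP[w jw] : exists y, g m y = g m x by exists x.
  by rewrite -[LHS]jw (J0 w) linear0.
left; have kerf x : f x = 0 -> x = 0.
  move=> fx; case: (posnP m) => [m0|]; last first.
    case em : m => [//|m'] _.
    have /iP[z <-] : g m x = 0 by rewrite em /= -iterS iterSr fx; apply: (linear0 (g m')).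
    by rewrite (K0 z) linear0.
  have [b0 a0] : (b = 0 /\ a = 0)%N by move: m0; rewrite /m; lia.
  by have := ka x; rewrite a0 /=; apply.
have inj_f : injective f.
  by move=> x y e; apply/subr0_eq/kerf; rewrite linearB e subrr.
have /choice[h hP] := inj_endo_surj fgU inj_f.
by exists h => // x; apply: inj_f; rewrite hP.
Qed.

End ArtinAlgebra.

(** * Decompositions into indecomposable modules *)

Section KrullSchmidt.

Variables (R : comPzRingType) (A : algType R).
Implicit Types K M N U V W X Y Z F : lmodType A.
Hypothesis hA : artin_algebra A.

Lemma zero_prod_iso U W : zero_module W -> isomorphic U (U * W)%type.
Proof.
move=> W0; exists (lin_of (pair_linear idfun (\0 : {linear U -> W}))), fst => //.
by move=> [x y]; rewrite /= [y]W0.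
Qed.

(** This says that the endomorphism ring of [U] is local. For [s] the identity,
if [f] is nilpotent then [1 - f] is injective, hence bijective. *)
Lemma indec_endo_local U (f g s : {linear U -> U}) : finitely_generated U ->
  indecomposable U -> bijective s -> (forall x, s x = f x + g x) ->
  bijective f \/ bijective g.
Proof.
move=> fgU iU bs sE; have [t [st ts]] := bij_inverse bs.
have tfg x : t (f x) + t (g x) = x by rewrite -linearD -sE st.
have bt : bijective t by exists s.
have back (h : {linear U -> U}) : bijective (t \o h) -> bijective h.
  move=> bth; apply: (eq_bij (bij_comp bs bth)) => x /=; exact: ts.
case: (fitting hA (t \o f) fgU iU) => [/back|[m nil]]; [by left|right].
apply: back; have inj : injective (t \o g).
  move=> x y e; apply/subr0_eq; set z := x - y.
  have tgz : t (g z) = 0 by rewrite !linearB; apply/eqP; rewrite subr_eq0; apply/eqP.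
  have fz : t (f z) = z by rewrite -[RHS]tfg tgz addr0.
  by rewrite -[RHS](nil z); elim: m {nil} => //= m <-; rewrite fz.
have /choice[h hP] := inj_endo_surj hA fgU inj.
by exists h => // x; apply: inj; rewrite hP.
Qed.

Lemma indec_sum_bij U k (h : 'I_k -> {linear U -> U}) (s : {linear U -> U}) :
  finitely_generated U -> indecomposable U -> bijective s ->
  (forall x, s x = \sum_(a < k) h a x) -> exists a, bijective (h a).
Proof.
move=> fgU iU; elim: k h s => [|k IH] h s bs sE.
  case: iU => nz _; case: nz => x; apply: (bij_inj bs).
  by rewrite linear0 sE big_ord0.
have [|b0|b'] := indec_endo_local (f := h ord0) (g := s \- h ord0) fgU iU bs.
- by move=> x /=; rewrite addrC subrK.
- by exists ord0.
have [|a ba] := IH (fun a => h (lift ord0 a)) (s \- h ord0) b'.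
  by move=> x /=; rewrite sE big_ord_recl addrC addKr.
by exists (lift ord0 a).
Qed.

Lemma retract_through U W (f : {linear U -> W}) (g : {linear W -> U}) :
  bijective (g \o f) -> retract U W.
Proof. by move=> /bij_inverse[t [tK _]]; exists f, (t \o g). Qed.

Lemma indec_retract_prod U W1 W2 : finitely_generated U -> indecomposable U ->
  retract U (W1 * W2)%type -> retract U W1 \/ retract U W2.
Proof.
move=> fgU iU [a [b ab]].
pose b1 : {linear W1 -> U} := b \o lin_of (pair_linear idfun (\0 : {linear W1 -> W2})).
pose b2 : {linear W2 -> U} := b \o lin_of (pair_linear (\0 : {linear W2 -> W1}) idfun).
have [||/retract_through|/retract_through] := indec_endo_local (f := b1 \o (fst \o a))
  (g := b2 \o (snd \o a)) (s := idfun) fgU iU.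
- by exists idfun.
- move=> x /=; rewrite -linearD -[LHS]ab; congr (b _).
  by rewrite [LHS]surjective_pairing; congr pair; rewrite /= ?addr0 ?add0r.
- by left.
- by right.
Qed.

(** The identity of [U] is the sum over the coordinates of endomorphisms that
factor through [V], and one of these is invertible. *)
Lemma indec_retract_pow U V k : finitely_generated U -> indecomposable U ->
  retract U {ffun 'I_k -> V} -> retract U V.
Proof.
move=> fgU iU [a [b ab]].
have injP (i : 'I_k) : linear (fun x : V => [ffun j => if j == i then x else 0]).
  move=> s x y; apply/ffunP => j; rewrite !ffunE; case: eqP => // _.
  by rewrite scaler0 addr0.
have projP (i : 'I_k) : linear (fun v : {ffun 'I_k -> V} => v i).
  by move=> s x y; rewrite !ffunE.
have [|x|i /retract_through //] := indec_sum_bij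
  (h := fun i => (b \o lin_of (injP i)) \o (lin_of (projP i) \o a))
  (s := idfun) fgU iU; first by exists idfun.
rewrite /= -linear_sum -[LHS]ab; congr (b _); apply/ffunP => i.
rewrite sum_ffunE (bigD1 i) //= big1 => [|j ne_ji]; first by rewrite ffunE eqxx addr0.
by rewrite ffunE eq_sym (negPf ne_ji).
Qed.

(** Induction on the length. *)
Lemma fg_module_ind (P : lmodType A -> Prop) :
  (forall N, zero_module N -> P N) ->
  (forall N, finitely_generated N -> indecomposable N -> P N) ->
  (forall U W N, finitely_generated U -> finitely_generated W ->
     isomorphic (U * W)%type N -> P U -> P W -> P N) ->
  forall N, finitely_generated N -> P N.
Proof.
move=> P0 Pi Pp N fgN; have [n] := ubnP (module_length N).
elim: n N fgN => // n IH N fgN lenN.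
case: (pselect (zero_module N)) => [/P0 //|nzN].
case: (pselect (indecomposable N)) => [/Pi|nN]; first by apply.
have /existsNP[U /existsNP[W /not_implyP[iso /not_orP[nU nW]]]] :
    ~ forall U W, isomorphic (U * W)%type N -> zero_module U \/ zero_module W.
  by move=> h; apply: nN.
have rUN := retract_trans (retract_fst U W) (retract_iso iso).
have rWN := retract_trans (retract_snd U W) (retract_iso iso).
have fgU := fg_retract rUN fgN; have fgW := fg_retract rWN fgN.
have := module_length_iso hA (fg_prod hA fgU fgW) iso.
rewrite module_length_prod // => lenUW.
have lU := module_length_gt0 hA fgU nU; have lW := module_length_gt0 hA fgW nW.
by apply: (Pp _ _ _ fgU fgW iso); apply: IH => //; lia.
Qed.

Lemma projective_iso U V : isomorphic U V -> projective U -> projective V.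
Proof. by move/isomorphic_sym/retract_iso; apply: projective_retract. Qed.

Lemma nonprojective_indec_retract N : finitely_generated N -> ~ projective N ->
  exists U, [/\ finitely_generated U, indecomposable U, ~ projective U & retract U N].
Proof.
move: N; apply: fg_module_ind => [N /projective_zero //|N fgN iN nN|].
  by exists N; split=> //; apply/retract_iso/isomorphic_refl.
move=> U W N fgU fgW iso hU hW nN.
case: (pselect (projective U)) => [pU|/hU[X [fgX iX nX rX]]]; last first.
  exists X; split=> //; apply: retract_trans rX _.
  exact: retract_trans (retract_fst U W) (retract_iso iso).
case: (pselect (projective W)) => [pW|/hW[X [fgX iX nX rX]]]; last first.
  exists X; split=> //; apply: retract_trans rX _.
  exact: retract_trans (retract_snd U W) (retract_iso iso).
by case: nN; apply: projective_iso iso (projective_prod pU pW).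
Qed.

(** The [X j] represent all nonprojective indecomposable summands of [V];
repetitions are harmless for the counting argument. *)
Definition covers_indec V t (X : 'I_t -> lmodType A) : Prop :=
  forall U, finitely_generated U -> indecomposable U -> ~ projective U ->
    retract U V -> exists j, isomorphic U (X j).

Lemma indec_retract_indec U V : indecomposable U -> indecomposable V -> retract U V ->
  isomorphic U V.
Proof.
move=> [nz _] [_ iV] /summand_retract[W iso].
case: (iV _ _ iso) => // W0; exact: isomorphic_trans (zero_prod_iso U W0) iso.
Qed.

(** Decompose [V] into indecomposable modules. By locality of the endomorphism
rings each indecomposable summand of [V] is isomorphic to one of them. *)
Lemma finitely_many_indec V : finitely_generated V ->
  exists t (X : 'I_t -> lmodType A), covers_indec V X.
Proof.
move: V; apply: fg_module_ind => [V V0|V fgV iV|U W V fgU fgW iso].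
- exists 0%N, (fun=> V) => U _ [nz _] _ [a [b ab]].
  by case: nz => x; rewrite -[x]ab (V0 (a x)) linear0.
- exists 1%N, (fun=> V) => U _ iU _ rU.
  by exists ord0; apply: indec_retract_indec.
move=> [t1 [X1 c1]] [t2 [X2 c2]].
exists (t1 + t2)%N, (fun j => match fintype.split j with inl i => X1 i | inr i => X2 i end).
move=> Y fgY iY nY rY.
have rUW := retract_trans rY (retract_iso (isomorphic_sym iso)).
case: (indec_retract_prod fgY iY rUW) => [/(c1 _ fgY iY nY)[i]|/(c2 _ fgY iY nY)[i]] isoY.
  by exists (lshift t2 i); rewrite (unsplitK (inl i)).
by exists (rshift t1 i); rewrite (unsplitK (inr i)).
Qed.

(** The functions that factor through the split Grothendieck group of finitely
generated modules modulo projective modules. *)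
Record stable_additive (l : lmodType A -> nat) : Prop := StableAdditive {
  stable_additive_iso : forall U V, finitely_generated U -> isomorphic U V -> l U = l V;
  stable_additive_prod : forall U V, finitely_generated U -> finitely_generated V ->
    l (U * V)%type = (l U + l V)%N;
  stable_additive_proj : forall U, finitely_generated U -> projective U -> l U = 0%N }.

(** The class of [V0] in the Grothendieck group is a combination of the classes
of the [X j]. The multiplicities do not depend on [l]: they are used
simultaneously for the lengths of Ext in many degrees. *)
Lemma stable_multiplicities V0 t (X : 'I_t -> lmodType A) :
  finitely_generated V0 -> covers_indec V0 X ->
  exists m : 'I_t -> nat, forall l, stable_additive l ->
    l V0 = (\sum_(j < t) m j * l (X j))%N.
Proof.
move: V0; apply: fg_module_ind => [V V0 _|V fgV iV cV|U W V fgU fgW iso hU hW cV].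
- exists (fun=> 0%N) => l la; rewrite big1 // stable_additive_proj //.
    by exists 0%N, (fun=> 0) => x; exists (fun=> 0); rewrite big_ord0 (V0 x).
  exact: projective_zero.
- case: (pselect (projective V)) => [pV|nV].
    by exists (fun=> 0%N) => l la; rewrite big1 // stable_additive_proj.
  have [j isoj] := cV V fgV iV nV (retract_iso (isomorphic_refl V)).
  exists (fun i => (i == j)%N : nat) => l la; rewrite (bigD1 j) //= eqxx mul1n.
  rewrite big1 ?addn0 => [|i /negPf-> //].
  exact: stable_additive_iso isoj.
have [|m1 h1] := hU.
  move=> Y fgY iY nY rY; apply: cV => //; apply: retract_trans rY _.
  exact: retract_trans (retract_fst U W) (retract_iso iso).
have [|m2 h2] := hW.
  move=> Y fgY iY nY rY; apply: cV => //; apply: retract_trans rY _.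
  exact: retract_trans (retract_snd U W) (retract_iso iso).
exists (fun j => (m1 j + m2 j)%N) => l la.
rewrite -(stable_additive_iso la (fg_prod hA fgU fgW) iso) stable_additive_prod //.
rewrite h1 // h2 // -big_split /=; apply: eq_bigr => j _; by rewrite mulnDl.
Qed.

End KrullSchmidt.

(** * Syzygies and the vanishing of Ext *)

Section Syzygies.

Variable A : pzRingType.
Implicit Types K M N U V W X Y Z F P Q : lmodType A.

Lemma lift_epi P Y Q (p : {linear Q -> Y}) (f : {linear P -> Y}) :
  projective P -> surjective p -> exists h : {linear P -> Q}, forall x, p (h x) = f x.
Proof. by move=> pP; apply: pP. Qed.

Lemma syzygy_map Z Q Y Z' Q' Y' (i : {linear Z -> Q}) (p : {linear Q -> Y})
    (i' : {linear Z' -> Q'}) (p' : {linear Q' -> Y'}) (f : {linear Y -> Y'}) :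
  projective Q -> short_exact i p -> short_exact i' p' ->
  exists (F : {linear Q -> Q'}) (g : {linear Z -> Z'}),
    (forall x, p' (F x) = f (p x)) /\ (forall x, i' (g x) = F (i x)).
Proof.
move=> pQ [_ exip _] [inj_i' exip' sp'].
have [F FP] := lift_epi (f \o p) pQ sp'.
have [x|g gP] := factor_inj (h := F \o i) inj_i'.
  by apply/exip'; rewrite /= FP /= (_ : p (i x) = 0) ?linear0 //; apply/exip; exists x.
by exists F, g.
Qed.

(** This makes the syzygy a functor on the stable category: if [f] factors
through a projective module then [F] differs by a map into [Z'] from a map that
vanishes on [Z]. *)
Lemma syzygy_map_stable Z Q Y Z' Q' Y' (i : {linear Z -> Q}) (p : {linear Q -> Y})
    (i' : {linear Z' -> Q'}) (p' : {linear Q' -> Y'}) (f : {linear Y -> Y'})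
    (F : {linear Q -> Q'}) (g : {linear Z -> Z'}) :
  projective Q -> short_exact i p -> short_exact i' p' ->
  (forall x, p' (F x) = f (p x)) -> (forall x, i' (g x) = F (i x)) ->
  stably_zero f -> stably_zero g.
Proof.
move=> pQ [_ exip _] [inj_i' exip' sp'] FP gP [P [u [v [pP uv]]]].
have [w wP] := lift_epi v pP sp'.
have [x|k kP] := factor_inj (h := F \- ((w \o u) \o p)) inj_i'.
  by apply/exip'; rewrite /= linearB FP wP uv subrr.
exists Q, i, k; split=> // x; apply: inj_i'; rewrite kP gP /=.
by rewrite (_ : p (i x) = 0) ?(linear0 u) ?(linear0 w) ?subr0 //; apply/exip; exists x.
Qed.

(** A relative of [is_syzygy] in which the projective modules of the successive
presentations are finitely generated, but the presentations need not be minimal. *)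
Fixpoint fg_syzygy n M Z : Prop :=
  if n is m.+1 then exists Y, fg_syzygy m M Y /\
    exists (Q : lmodType A) (i : {linear Z -> Q}) (p : {linear Q -> Y}),
      [/\ finitely_generated Q, projective Q & short_exact i p]
  else isomorphic M Z.

Lemma fg_syzygy_iso n M Y Z : fg_syzygy n M Y -> isomorphic Y Z -> fg_syzygy n M Z.
Proof.
case: n => [|n] /=; first exact: isomorphic_trans.
move=> [X [sX [Q [i [p [fgQ pQ [inj_i exip sp]]]]]]] /isomorphic_sym[f [g fK gK]].
exists X; split=> //; exists Q, (i \o f), p; split=> //; split=> //.
  exact: inj_comp inj_i (can_inj fK).
move=> y; split=> [/exip[x <-]|[x <-]]; first by exists (g x); rewrite /= gK.
by apply/exip; exists (f x).
Qed.

Definition stably_equivalent X Y : Prop :=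
  exists (a : {linear X -> Y}) (b : {linear Y -> X}),
    stably_zero ((b \o a) \- idfun) /\ stably_zero ((a \o b) \- idfun).

Lemma stably_zero0 X Y (f : {linear X -> Y}) : (forall x, f x = 0) -> stably_zero f.
Proof.
move=> f0; exists {ffun 'I_0 -> A^o}, \0, \0.
by split=> [|x]; [apply: projective_free|rewrite f0].
Qed.

(** A weak form of Schanuel's lemma. *)
Lemma fg_syzygy_unique n M Z Z' : fg_syzygy n M Z -> fg_syzygy n M Z' ->
  stably_equivalent Z Z'.
Proof.
elim: n Z Z' => [|n IH] Z Z' /=.
  move=> [f /bij_inverse[f' [fK f'K]]] [g /bij_inverse[g' [gK g'K]]].
  exists (g \o f'), (f \o g'); split; apply: stably_zero0 => x /=.
    by rewrite gK f'K subrr.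
  by rewrite fK g'K subrr.
move=> [Y [sY [Q [i [p [fgQ pQ ip]]]]]] [Y' [sY' [Q' [i' [p' [fgQ' pQ' ip']]]]]].
have [a [b [ba ab]]] := IH _ _ sY sY'.
have [F [f [pF iF]]] := syzygy_map a pQ ip ip'.
have [G [g [pG iG]]] := syzygy_map b pQ' ip' ip.
exists f, g; split.
  apply: (syzygy_map_stable (F := (G \o F) \- idfun) pQ ip ip _ _ ba) => x /=.
    by rewrite linearB pG pF.
  by rewrite linearB iG iF.
apply: (syzygy_map_stable (F := (F \o G) \- idfun) pQ' ip' ip' _ _ ab) => x /=.
  by rewrite linearB pF pG.
by rewrite linearB iF iG.
Qed.

Section Resolution.

Variables (K F : nat -> lmodType A).
Variables (iota : forall i, {linear K i.+1 -> F i}) (pi : forall i, {linear F i -> K i}).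
Hypothesis exF : forall i, short_exact (iota i) (pi i).
Hypothesis projF : forall i, projective (F i).

(** The vanishing of Ext^(i+1)(K_0, N), as the cokernel of the restriction map
from Hom(F_i, N) to Hom(K_(i+1), N). *)
Definition extendable i N : Prop := forall f : {linear K i.+1 -> N},
  exists g : {linear F i -> N}, forall x, g (iota i x) = f x.

Let pi_iota i x : pi i (iota i x) = 0.
Proof. by have [_ ex _] := exF i; apply/ex; exists x. Qed.

Let pi_surj i : surjective (pi i).
Proof. by have [] := exF i. Qed.

Lemma factor_pi i N (h : {linear F i -> N}) : (forall x, h (iota i x) = 0) ->
  exists g : {linear K i -> N}, forall x, g (pi i x) = h x.
Proof.
move=> h0; apply: (factor_surj (@pi_surj i)) => x px.
by have [_ ex _] := exF i; have /ex[y <-] := px.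
Qed.

Lemma extendable_retract i N N' : retract N N' -> extendable i N' -> extendable i N.
Proof.
move=> [a [b ab]] ext f; have [g gP] := ext (a \o f).
by exists (b \o g) => x; rewrite /= gP /= ab.
Qed.

Lemma extendable_pow i N k : extendable i N -> extendable i {ffun 'I_k -> N}.
Proof.
move=> ext f.
have projP (j : 'I_k) : linear (fun v : {ffun 'I_k -> N} => v j).
  by move=> s x y; rewrite !ffunE.
have /choice[g gP] j := ext (lin_of (projP j) \o f).
have tupP : linear (fun x => [ffun j => g j x]).
  by move=> s x y; apply/ffunP => j; rewrite !ffunE linearP.
by exists (lin_of tupP) => x; apply/ffunP => j; rewrite ffunE gP.
Qed.

Lemma extendable_projective i N : extendable i A^o -> finitely_generated N ->
  projective N -> extendable i N.
Proof.
move=> extA fgN pN; have [k rN] := fg_projective_free fgN pN.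
exact: (extendable_retract rN (extendable_pow extA)).
Qed.

Section ShortExact.

Variables (V1 V0 Z : lmodType A) (u : {linear V1 -> V0}) (p : {linear V0 -> Z}).
Hypothesis up : short_exact u p.

(** The part Ext^(j+1)(K_0, Z) -> Ext^(j+2)(K_0, V1) -> Ext^(j+2)(K_0, V0) of the
long exact sequence, when the first term vanishes. *)
Lemma ext_inj j (f : {linear K j.+2 -> V1}) (h : {linear F j.+1 -> V0}) :
  extendable j Z -> (forall x, h (iota _ x) = u (f x)) ->
  exists h' : {linear F j.+1 -> V1}, forall x, h' (iota _ x) = f x.
Proof.
have [inj_u exup sp] := up; have pu x : p (u x) = 0 by apply/exup; exists x.
move=> extZ hP; have [x|c cP] := factor_pi (h := p \o h); first by rewrite /= hP pu.
have [d dP] := extZ c; have [w wP] := lift_epi d (@projF j) sp.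
have [x|h' h'P] := factor_inj (h := h \- ((w \o iota j) \o pi j.+1)) inj_u.
  by apply/exup; rewrite /= linearB wP dP cP subrr.
exists h' => x; apply: inj_u; rewrite h'P /= pi_iota.
by rewrite linear0 [w 0]linear0 subr0 hP.
Qed.

(** The part Ext^(j+1)(K_0, V1) -> Ext^(j+1)(K_0, V0) -> Ext^(j+1)(K_0, Z) of the
long exact sequence, when the last term vanishes. *)
Lemma ext_surj j (g : {linear K j.+1 -> V0}) : extendable j Z ->
  exists (f : {linear K j.+1 -> V1}) (h : {linear F j -> V0}),
    forall x, g x = u (f x) + h (iota j x).
Proof.
have [inj_u exup sp] := up; move=> extZ; have [d dP] := extZ (p \o g).
have [h hP] := lift_epi d (@projF j) sp.
have [x|f fP] := factor_inj (h := g \- (h \o iota j)) inj_u.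
  by apply/exup; rewrite /= linearB hP dP subrr.
by exists f, h => x; rewrite fP /= subrK.
Qed.

(** When Ext^(j+1)(K_0, V1) -> Ext^(j+1)(K_0, V0) is injective, the connecting map
on Ext^j(K_0, Z) vanishes, and even the homomorphisms that represent the classes
lift. *)
Lemma lift_of_ext_inj j (c : {linear K j -> Z}) :
  (forall (f : {linear K j.+1 -> V1}) (h : {linear F j -> V0}),
     (forall x, h (iota _ x) = u (f x)) ->
     exists h' : {linear F j -> V1}, forall x, h' (iota _ x) = f x) ->
  exists d : {linear K j -> V0}, forall x, p (d x) = c x.
Proof.
have [inj_u exup sp] := up; have pu x : p (u x) = 0 by apply/exup; exists x.
move=> inj; have [h hP] := lift_epi (c \o pi j) (@projF j) sp.
have [x|f fP] := factor_inj (h := h \o iota j) inj_u.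
  by apply/exup; rewrite /= hP /= pi_iota linear0.
have [h' h'P] := inj f h (fun x => esym (fP x)).
have [x|d dP] := factor_pi (h := h \- (u \o h')).
  by rewrite /= h'P fP subrr.
exists d => x; have [y <-] := pi_surj x.
by rewrite dP /= linearB pu subr0 hP.
Qed.

Lemma extendable_shift j : extendable j.+1 V0 -> extendable j Z -> extendable j.+1 V1.
Proof.
by move=> ext0 extZ f; have [h hP] := ext0 (u \o f); apply: ext_inj hP.
Qed.

End ShortExact.

(** Dimension shifting: Ext^(i+1)(K_0, Z) = Ext^(i+1-s)(K_0, M) when [i] is at
least [s]. *)
Lemma extendable_syzygy M t s Z i : (forall j, extendable j A^o) ->
  (forall j, (j <= t)%N -> extendable j M) -> fg_syzygy s M Z ->
  (s <= i <= s + t)%N -> extendable i Z.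
Proof.
move=> extA extM; elim: s Z i => [|s IH] Z i /=.
  by move=> /isomorphic_sym/retract_iso rZ /extM; apply: extendable_retract.
move=> [Y [sY [Q [u [p [fgQ pQ up]]]]]]; case: i => // i le_i.
apply: (extendable_shift up); first exact: extendable_projective.
exact: IH sY le_i.
Qed.

Lemma syzygy_resolution M s : (forall i, finitely_generated (F i)) ->
  isomorphic M (K 0) -> fg_syzygy s M (K s).
Proof.
move=> fgF isoM; elim: s => [|s IH] //=; exists (K s); split=> //.
by exists (F s), (iota s), (pi s).
Qed.

(** If [K (s + 1)] is projective then its embedding into [F s] splits, so that
[K s] is a summand of [F s]. *)
Lemma projective_descend s : (forall j, extendable j A^o) ->
  (forall i, finitely_generated (K i)) -> projective (K s) -> projective (K 0).
Proof.
move=> extA fgK; elim: s => // s IH pK; apply: IH.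
have [r rP] := extendable_projective (extA s) (fgK _) pK idfun.
have [x|c cP] := factor_pi (h := idfun \- (iota s \o r)).
  by rewrite /= rP subrr.
apply: projective_retract (@projF s); exists c, (pi s) => x.
by have [y <-] := pi_surj x; rewrite cP /= linearB pi_iota subr0.
Qed.

Lemma stably_zero_extendable i Z (f : {linear K i.+1 -> Z}) : extendable i Z ->
  stably_zero f.
Proof. by move=> ext; have [g gP] := ext f; exists (F i), (iota i), g. Qed.

Lemma extendable_Ext M q N (e : {linear K 0 -> M}) : bijective e ->
  Ext_zero q.+1 M N -> extendable q N.
Proof.
move=> be ext f; have [e' [eK e'K]] := bij_inverse be.
have augS : surjective (e \o pi 0).
  by move=> y; have [x ex] := pi_surj (e' y); exists x; rewrite /= ex e'K.
have ker_pi i x : pi i x = 0 <-> exists y, iota i y = x by have [_ ex _] := exF i; apply: ex.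
have inj_iota i : injective (iota i) by have [] := exF i.
have ex0 : exact (iota 0 \o pi 1) (e \o pi 0).
  move=> y; split=> [/= ey|[x <-] /=]; last by rewrite pi_iota linear0.
  have /ker_pi[z <-] : pi 0 y = 0 by apply: (can_inj eK); rewrite ey linear0.
  by have [x <-] := pi_surj z; exists x.
have exS i : exact (iota i.+1 \o pi i.+2) (iota i \o pi i.+1).
  move=> y; split=> [/= ey|[x <-] /=]; last by rewrite pi_iota linear0.
  have /ker_pi[z <-] : pi i.+1 y = 0 by apply: (inj_iota i); rewrite ey linear0.
  by have [x <-] := pi_surj z; exists x.
pose Pr := @ProjectiveResolution A M F (fun i => iota i \o pi i.+1) (e \o pi 0)
  projF augS ex0 exS.
have [x|g gP] := ext Pr (f \o pi q.+1); first by rewrite /= pi_iota linear0.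
by exists g => x; have [y <-] := pi_surj x; rewrite [RHS]gP.
Qed.

End Resolution.

End Syzygies.

(** * The length of Ext *)

Section FreeResolution.

Variables (R : comPzRingType) (A : algType R).
Implicit Types K M N U V W X Y Z F P Q : lmodType A.
Hypothesis hA : artin_algebra A.

(** Bundled as data, in order that a resolution be defined by iteration. *)
Record presentation X : Type := Presentation {
  pres_cover : lmodType A;
  pres_kernel : lmodType A;
  pres_incl : {linear pres_kernel -> pres_cover};
  pres_proj : {linear pres_cover -> X};
  pres_cover_fg : finitely_generated pres_cover;
  pres_kernel_fg : finitely_generated pres_kernel;
  pres_projective : projective pres_cover;
  pres_exact : short_exact pres_incl pres_proj }.

Lemma presentation_exists X : finitely_generated X -> exists p : presentation X, True.
Proof.
move=> fgX; have [k [p ps]] := fg_cover fgX.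
have [K [i [inj_i iP]]] := submod_embedding (kernel_submod p _).
have fgF := fg_ffun k (fg_regular A).
by exists (Presentation fgF (fg_sub hA inj_i fgF) (@projective_free A k) (And3 inj_i iP ps)).
Qed.

Lemma fg_resolution_exists M : finitely_generated M ->
  exists (K F : nat -> lmodType A) (iota : forall i, {linear K i.+1 -> F i})
         (pi : forall i, {linear F i -> K i}),
  [/\ isomorphic (K 0) M,
      forall i, finitely_generated (K i), forall i, finitely_generated (F i),
      forall i, projective (F i) & forall i, short_exact (iota i) (pi i)].
Proof.
move=> fgM; pose T := {X : lmodType A | finitely_generated X}.
pose pres (X : T) : presentation (sval X) := sval (cid (presentation_exists (svalP X))).
pose next (X : T) : T := exist _ (pres_kernel (pres X)) (pres_kernel_fg (pres X)).
pose K n := iter n next (exist _ M fgM).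
exists (fun n => sval (K n)), (fun n => pres_cover (pres (K n))),
  (fun n => pres_incl (pres (K n))), (fun n => pres_proj (pres (K n))).
split=> [|i|i|i|i]; first exact: isomorphic_refl.
- exact: svalP.
- exact: pres_cover_fg.
- exact: pres_projective.
- exact: pres_exact.
Qed.

Lemma fg_syzygy_fg n M Z : finitely_generated M -> fg_syzygy n M Z -> finitely_generated Z.
Proof.
elim: n Z => [|n IH] Z fgM /=; first by move/fg_iso; apply.
by move=> [Y [sY [Q [i [p [fgQ pQ [inj_i _ _]]]]]]]; apply: fg_sub inj_i fgQ.
Qed.

Lemma fg_syzygy_cat n j M Y Z : finitely_generated M -> fg_syzygy j M Y ->
  is_syzygy n Y Z -> fg_syzygy (j + n) M Z.
Proof.
move=> fgM sY; elim: n Z => [|n IH] Z /=.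
  by rewrite addn0; apply: fg_syzygy_iso.
move=> [X [/IH sX [Q [i [p [cov ip]]]]]]; rewrite addnS /=.
exists X; split=> //; exists Q, i, p; split=> //; last by case: cov.
exact: projective_cover_fg cov (fg_syzygy_fg fgM sX).
Qed.

Section ExtLength.

Variables (K F : lmodType A) (iota : {linear K -> F}).
Hypothesis fgK : finitely_generated K.

Definition is_hom N (v : K -> N) : Prop := exists f : {linear K -> N}, v = f.

Definition is_restriction N (v : K -> N) : Prop :=
  exists g : {linear F -> N}, v = g \o iota.

(** For a short exact sequence 0 -> K -> F -> X -> 0 with [F] projective, this is
the length over [R] of Ext^1(X, N). *)
Definition ext_length N : nat :=
  len (@base_scalar R A) (@is_restriction N) (@is_hom N).

Lemma scale_linear N (r : R) U (f : {linear U -> N}) : linear (fun x => r%:A *: f x : N).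
Proof.
by move=> s x y; rewrite linearP scalerDr !scalerA mulr_algl mulr_algr.
Qed.

Lemma is_hom_submod N : submod (@base_scalar R A) (@is_hom N).
Proof.
split=> [|_ _ [f ->] [g ->]|_ _ [r ->] [f ->]]; first by exists \0.
  by exists (f \- g).
by exists (lin_of (scale_linear r f)).
Qed.

Lemma is_restriction_submod N : submod (@base_scalar R A) (@is_restriction N).
Proof.
split=> [|_ _ [f ->] [g ->]|_ _ [r ->] [f ->]]; first by exists \0.
  by exists (f \- g).
by exists (lin_of (scale_linear r f)).
Qed.

Lemma restriction_hom N v : @is_restriction N v -> is_hom v.
Proof. by case=> g ->; exists (g \o iota). Qed.

(** A homomorphism is determined by its values at generators of [K], and so
Hom(K, N) embeds into a power of [N]. *)
Lemma ext_bounded N : finitely_generated N ->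
  bounded (@base_scalar R A) (@is_restriction N) (@is_hom N).
Proof.
move=> fgN; have [k [g gP]] := fgK.
have evP : linear (fun v : K -> N => [ffun j => v (g j)]).
  by move=> s v w; apply/ffunP => j; rewrite !ffunE.
have [n nch] := fg_finite_length hA (fg_ffun k fgN); exists n => ch; apply: nch.
have {}ch : chain (@base_scalar R A) n.+1 (fun v : K -> N => v = 0) (@is_hom N).
  by apply: chain_weaken ch => // _ ->; apply: submod0 (is_restriction_submod N).
have := chain_im (f := lin_of evP) (is_hom_submod N) (submod_zero _ _) _ ch.
have inj v : is_hom v -> lin_of evP v = 0 -> v = 0.
  move=> [f ->] /ffunP fg0; apply/funext => x; have [c ->] := gP x.
  rewrite linear_sum big1 // => j _; have := fg0 j; rewrite !ffunE /=.
  by rewrite linearZ /= => ->; rewrite scaler0.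
by move/(_ inj); apply: chain_weaken.
Qed.

Lemma postcomp_linear N N' (f : {linear N -> N'}) :
  linear (fun v : K -> N => f \o v : K -> N').
Proof. by move=> s v w; apply/funext => x /=; rewrite linearP. Qed.

Definition postcomp N N' (f : {linear N -> N'}) := lin_of (postcomp_linear f).

Lemma postcomp_hom N N' (f : {linear N -> N'}) v : is_hom v -> is_hom (postcomp f v).
Proof. by case=> g ->; exists (f \o g). Qed.

Lemma postcomp_restriction N N' (f : {linear N -> N'}) v :
  is_restriction v -> is_restriction (postcomp f v).
Proof. by case=> g ->; exists (f \o g). Qed.

Lemma ext_length_additive :
  (forall N, finitely_generated N -> projective N ->
     forall f : {linear K -> N}, exists g : {linear F -> N}, forall x, g (iota x) = f x) ->
  @stable_additive R A ext_length.
Proof.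
move=> ext; split=> [U V fgU [f bf]|U V fgU fgV|U fgU pU].
- have [g [fK gK]] := bij_inverse bf; symmetry.
  apply: (len_iso (f := postcomp f) (is_hom_submod U) (is_restriction_submod V)
    (is_hom_submod V) (ext_bounded fgU) (@restriction_hom U)).
  + exact: postcomp_restriction.
  + move=> v hv; exists (postcomp g v); first exact: postcomp_hom.
    rewrite (_ : v - _ = 0); first exact: submod0 (is_restriction_submod V).
    by apply/funext => x; apply/subr0_eq; rewrite subr0; apply/eqP; rewrite subr_eq0 /= gK.
  + exact: restriction_hom.
  + exact: postcomp_hom.
  + move=> v _ /(postcomp_restriction g); congr is_restriction.
    by apply/funext => x /=; rewrite fK.
- pose f := lin_of (pair_linear (postcomp (fst : {linear (U * V)%type -> U}))
    (postcomp (snd : {linear (U * V)%type -> V}))).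
  have [_ <-] := len_prod (is_restriction_submod U) (is_hom_submod U)
    (is_restriction_submod V) (is_hom_submod V) (@restriction_hom U) (@restriction_hom V)
    (ext_bounded fgU) (ext_bounded fgV).
  symmetry; apply: (len_iso (f := f) (is_hom_submod _) _ _
    (ext_bounded (fg_prod hA fgU fgV)) (@restriction_hom _)).
  + exact: submod_prod (is_restriction_submod U) (is_restriction_submod V).
  + exact: submod_prod (is_hom_submod U) (is_hom_submod V).
  + by move=> v rv; split; apply: postcomp_restriction.
  + move=> [v w] [/= [g vg] [h wh]]; exists (fun x => (g x, h x)).
      by exists (lin_of (pair_linear g h)).
    split; [change (is_restriction (v - (g : K -> U)))
           |change (is_restriction (w - (h : K -> V)))].
      by rewrite -vg subrr; apply: submod0 (is_restriction_submod U).
    by rewrite -wh subrr; apply: submod0 (is_restriction_submod V).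
  + by move=> v [rv rw]; split; apply: restriction_hom.
  + by move=> v hv; split; apply: postcomp_hom.
  + move=> v _ [[g vg] [h vh]]; exists (lin_of (pair_linear g h)).
    apply/funext => x; have := congr1 (@^~ x) vg; have := congr1 (@^~ x) vh.
    by rewrite /=; case: (v x) => y z /= -> ->.
- apply: len_eq0; [exact: ext_bounded|exact: restriction_hom|].
  move=> _ [f ->]; have [g gP] := ext U fgU pU f.
  by exists g; apply/funext => x; rewrite /= gP.
Qed.

End ExtLength.

End FreeResolution.

Arguments postcomp {R A K N N'} f.

(** * A rank argument *)

Section Triangular.

(** Consider the square matrix with entries (a_j - b_j) . E_i. Below the diagonal
it vanishes, and its diagonal entries are nonzero except at the bad indices. It
has rank at most [t], as a product of matrices with inner dimension [t]. There
are at most [t] bad indices, so a diagonal correction of rank at most [t] turns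
all the diagonal entries at bad indices into 1; but an invertible matrix of size
[2 * t + 1] is not of rank at most [2 * t]. *)
Lemma triangular_rank (t : nat) (E : 'I_(2 * t + 1) -> 'I_t -> nat)
    (a b : 'I_(2 * t + 1) -> 'I_t -> nat) (bad : 'I_(2 * t + 1) -> option 'I_t) :
  (forall i j : 'I_(2 * t + 1), (j < i)%N ->
     \sum_(k < t) a j k * E i k = \sum_(k < t) b j k * E i k)%N ->
  (forall j, bad j = None ->
     \sum_(k < t) a j k * E j k <> \sum_(k < t) b j k * E j k)%N ->
  (forall i j k, bad i = Some k -> bad j = Some k -> i = j) -> False.
Proof.
move=> below diag inj.
pose D : 'M[rat]_(_, _) := \matrix_(k, j) ((a j k)%:R - (b j k)%:R).
pose E' : 'M[rat]_(_, _) := \matrix_(i, k) (E i k)%:R.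
pose c i : rat := 1 - (E' *m D) i i.
pose Q1 : 'M[rat]_(_, _) := \matrix_(i, k) (if bad i == Some k then c i else 0).
pose Q2 : 'M[rat]_(_, _) := \matrix_(k, j) (bad j == Some k)%:R.
pose P := row_mx E' Q1 *m col_mx D Q2.
have ED i j : (E' *m D) i j =
    (\sum_(k < t) a j k * E i k)%N%:R - (\sum_(k < t) b j k * E i k)%N%:R.
  rewrite mxE !natr_sum -sumrB; apply: eq_bigr => k _.
  by rewrite !mxE mulrBr !natrM ![_ * (E i k)%:R]mulrC.
have QQ i j : (Q1 *m Q2) i j = if (i == j) && (bad i != None) then c i else 0.
  rewrite mxE; case ebi : (bad i) => [k|]; last first.
    by rewrite andbF big1 // => k _; rewrite !mxE ebi mul0r.
  rewrite (bigD1 k) //= big1 ?addr0 => [|k' /negPf nk]; last first.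
    by rewrite !mxE ebi (_ : (Some k == Some k') = false) ?mul0r // eq_sym.
  rewrite !mxE ebi eqxx andbT; case: (eqVneq i j) => [<-|ne_ij].
    by rewrite ebi eqxx mulr1.
  case: eqP => [ebj|]; last by rewrite mulr0.
  by case/eqP: ne_ij; apply: inj ebi ebj.
have PE i j : P i j = (E' *m D) i j + (Q1 *m Q2) i j by rewrite /P mul_row_col mxE.
have trig : is_trig_mx P^T.
  apply/is_trig_mxP => j i lt_ji; rewrite mxE PE ED QQ below // subrr add0r.
  by rewrite -val_eqE gtn_eqF.
have detP : \det P != 0.
  rewrite -det_tr det_trig //; apply/prodf_neq0 => i _; rewrite mxE PE QQ eqxx.
  case ebi : (bad i) => [k|] /=; first by rewrite /c addrC subrK oner_eq0.
  rewrite addr0 ED subr_eq0 Num.Theory.eqr_nat; apply/eqP; exact: diag.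
have : (\rank P <= t + t)%N.
  by apply: leq_trans (mxrankM_maxl _ _) (rank_leq_col _).
rewrite mxrank_unit ?unitmxE ?unitfE //; lia.
Qed.

End Triangular.

(** * Projectivity from the vanishing of Ext *)

Section Main.

Variables (R : comPzRingType) (A : algType R).
Implicit Types M N U V W X Y Z P Q : lmodType A.
Hypothesis hA : artin_algebra A.

Section FixedResolution.

Variables (K F : nat -> lmodType A).
Variables (iota : forall i, {linear K i.+1 -> F i}) (pi : forall i, {linear F i -> K i}).
Hypothesis exF : forall i, short_exact (iota i) (pi i).
Hypothesis projF : forall i, projective (F i).
Hypothesis fgK : forall i, finitely_generated (K i).
Hypothesis fgF : forall i, finitely_generated (F i).

Variables (M : lmodType A) (u : nat).
Hypothesis isoM : isomorphic M (K 0).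
Hypothesis extA : forall i, extendable iota i A^o.
Hypothesis extM : forall i, (i <= u)%N -> extendable iota i M.

Let sK s : fg_syzygy s M (K s).
Proof. exact: (syzygy_resolution exF projF s fgF isoM). Qed.

Lemma ext_length_stable i : stable_additive (ext_length (iota i)).
Proof.
apply: (ext_length_additive hA (fgK _)) => N fgN pN.
exact: (extendable_projective (@extA i) fgN pN).
Qed.

Section Presented.

Variables (V1 V0 Z : lmodType A) (i : {linear V1 -> V0}) (p : {linear V0 -> Z}) (s : nat).
Hypotheses (ip : short_exact i p) (sZ : fg_syzygy s M Z).
Hypothesis fgV1 : finitely_generated V1.

Let extZ j : (s <= j <= s + u)%N -> extendable iota j Z.
Proof. exact: (extendable_syzygy exF projF extA extM sZ). Qed.

Let ext_lift j : (s <= j <= s + u)%N -> forall v, is_hom v ->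
  exists2 w : K j.+1 -> V1, is_hom w & is_restriction (iota j) (v - postcomp i w).
Proof.
move=> /extZ extj _ [g ->]; have [f [h gE]] := ext_surj projF ip g extj.
exists f; first by exists f.
exists h; apply/funext => x; rewrite /= -[RHS](addKr (i (f x))) -gE.
by rewrite addrC.
Qed.

(** In these degrees Ext(M, Z) vanishes on both sides of the map from Ext(M, V1)
to Ext(M, V0), which is therefore bijective. *)
Lemma ext_length_eq j : (s < j <= s + u)%N ->
  ext_length (iota j) V0 = ext_length (iota j) V1.
Proof.
case: j => // j lt_j; apply: (len_iso (f := postcomp i) (is_hom_submod _ V1)
  (is_restriction_submod (iota j.+1) V0) (is_hom_submod _ V0)
  (ext_bounded hA (iota j.+1) (fgK _) fgV1)
  (@restriction_hom _ _ _ _ (iota j.+1) V1)).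
- exact: postcomp_restriction.
- by apply: ext_lift; lia.
- exact: restriction_hom.
- exact: postcomp_hom.
move=> _ [f ->] [h hP].
have extj : extendable iota j Z by apply: extZ; lia.
have [|h' h'P] := ext_inj exF projF ip (f := f) (h := h) extj.
  by move=> x; have := congr1 (@^~ x) hP.
by exists h'; apply/funext => x; rewrite /= h'P.
Qed.

(** The map from Ext^(s+1)(M, V1) to Ext^(s+1)(M, V0) is still surjective. When
the lengths agree it is injective, so that the stable isomorphism from [K s] to
[Z] lifts to [V0], and the identity of [Z] factors stably through [V0]. *)
Lemma retract_of_ext_length_eq : ext_length (iota s) V0 = ext_length (iota s) V1 ->
  exists P, projective P /\ retract Z (V0 * P)%type.
Proof.
move=> eql.
have inj (f : {linear K s.+1 -> V1}) (h : {linear F s -> V0}) :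
    (forall x, h (iota s x) = i (f x)) ->
    exists h' : {linear F s -> V1}, forall x, h' (iota s x) = f x.
  move=> hP.
  have [|||g gP] := len_im_inj (f := postcomp i) (is_hom_submod _ V1)
    (is_restriction_submod (iota s) V1) (is_restriction_submod (iota s) V0)
    (is_hom_submod _ V0) (ext_bounded hA (iota s) (fgK _) fgV1)
    (@restriction_hom _ _ _ _ (iota s) V1) (@postcomp_restriction _ _ _ _ _ _ _ i)
    (ext_lift _) (@restriction_hom _ _ _ _ (iota s) V0) eql (x := f);
    rewrite ?leqnn ?leq_addr //.
  - by exists f.
  - by exists h; apply/funext => x; rewrite /= hP.
  by exists g => x; have := congr1 (@^~ x) gP.
have [a [b [_ [P [v [w [pP vw]]]]]]] := fg_syzygy_unique (sK s) sZ.
have [d dP] := lift_of_ext_inj exF projF ip a inj.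
exists P; split=> //.
exists (lin_of (pair_linear (d \o b) v)), ((p \o fst) \- (w \o snd)) => x /=.
by rewrite dP vw /= subKr.
Qed.

End Presented.

(** If [Z] is projective then so is [K s], which is stably equivalent to [Z]. *)
Lemma syzygy_nonprojective s Z : ~ projective M -> fg_syzygy s M Z -> ~ projective Z.
Proof.
move=> nM sZ pZ; apply: nM.
apply: projective_iso (isomorphic_sym isoM) _.
apply: (projective_descend exF projF (s := s) extA fgK).
have [a [b [[P [v [w [pP vw]]]] _]]] := fg_syzygy_unique (sK s) sZ.
apply: (projective_retract _ (projective_prod pZ pP)).
exists (lin_of (pair_linear a v)), ((b \o fst) \- (w \o snd)) => x /=.
by rewrite vw /= subKr.
Qed.

(** The vanishing of Ext^(s'-s)(M, M) makes all homomorphisms from [Z'] to [Z]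
stably zero, in particular the one that is the identity on a common summand. *)
Lemma syzygy_no_common_summand s s' Z Z' U : fg_syzygy s M Z -> fg_syzygy s' M Z' ->
  (s < s' <= (s + u).+1)%N -> retract U Z -> retract U Z' -> projective U.
Proof.
move=> sZ sZ' lt_ss' [a [b ab]] [a' [b' ab']].
case: s' => // s' in lt_ss' sZ' *.
have [c [d [_ cd]]] := fg_syzygy_unique (sK s'.+1) sZ'.
apply: stably_zero_id.
have e1 : stably_zero ((a \o b') \o c).
  apply: (stably_zero_extendable projF) => //.
  by apply: (extendable_syzygy exF projF extA extM sZ); lia.
have e2 : stably_zero ((((b \o a) \o b') \o (c \o d)) \o a').
  by apply: (stably_zero_comp (g := d \o a') (h := b) e1).
have e3 : stably_zero ((((b \o a) \o b') \o ((c \o d) \- idfun)) \o a').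
  exact: (stably_zero_comp (g := a') (h := (b \o a) \o b') cd).
have e4 : stably_zero (\- ((((b \o a) \o b') \o ((c \o d) \- idfun)) \o a')).
  exact: (stably_zero_comp (g := idfun) (h := \- idfun) e3).
apply: (stably_zeroD e2 e4) => x /=.
by rewrite !linearB /= opprK addNKr ab' ab.
Qed.

End FixedResolution.

(** The degrees [j + n] with [j <= 2 * t] are bad when a nonprojective summand of
the syzygy is isomorphic to some [X k]; this holds as soon as the lengths of
Ext^(j+n+1)(M, V0) and Ext^(j+n+1)(M, V1) agree. Distinct bad degrees involve
distinct [k], and [triangular_rank] gives a contradiction. *)
Theorem projective_of_ext n V t (X : 'I_t -> lmodType A) M : IT_witness n V ->
  covers_indec V X -> finitely_generated M ->
  (forall i, (0 < i)%N -> Ext_zero i M A^o) ->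
  (forall q, (1 <= q <= 2 * t + 1)%N -> Ext_zero q M M) -> projective M.
Proof.
move=> [fgV witV] cV fgM extA0 extM0; apply: contrapT => nM.
have [K [F [iota [pi [isoK fgK fgF projF exF]]]]] := fg_resolution_exists hA fgM.
have [e be] := isoK; have isoM := isomorphic_sym isoK.
(* the degree of Ext is shifted by one in extendable, and also in ext_length *)
have extA i : extendable iota i A^o by apply: (extendable_Ext exF projF be); apply: extA0.
have extM i : (i <= 2 * t)%N -> extendable iota i M.
  by move=> le_i; apply: (extendable_Ext exF projF be); apply: extM0; lia.
pose E i k := ext_length (iota i) (X k).
pose common s k := exists Z U, [/\ fg_syzygy s M Z, retract U Z, ~ projective U &
  isomorphic U (X k)].
have data (j : 'I_(2 * t + 1)) : exists d : ('I_t -> nat) * ('I_t -> nat) * option 'I_t,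
    [/\ forall i, (j + n < i <= j + n + 2 * t)%N ->
          (\sum_(k < t) d.1.1 k * E i k = \sum_(k < t) d.1.2 k * E i k)%N,
        d.2 = None -> (\sum_(k < t) d.1.1 k * E (j + n)%N k
          <> \sum_(k < t) d.1.2 k * E (j + n)%N k)%N &
        forall k, d.2 = Some k -> common (j + n)%N k].
  have sKj := syzygy_resolution exF projF j fgF isoM.
  have [Z [V0 [V1 [i [p [sYZ aV0 aV1 ip]]]]]] := witV _ (fgK j).
  have sZ := fg_syzygy_cat hA fgM sKj sYZ.
  have addV V' : in_add V V' -> finitely_generated V' /\ covers_indec V' X.
    case=> k /retract_summand rV'; split; first exact: fg_retract rV' (fg_ffun k fgV).
    move=> U fgU iU nU rU; apply: cV => //.
    exact: (indec_retract_pow hA fgU iU (retract_trans rU rV')).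
  have [fgV0 cV0] := addV _ aV0; have [fgV1 cV1] := addV _ aV1.
  have [a aP] := stable_multiplicities hA fgV0 cV0.
  have [b bP] := stable_multiplicities hA fgV1 cV1.
  have aE l := aP _ (ext_length_stable fgK extA l).
  have bE l := bP _ (ext_length_stable fgK extA l).
  have eqE l : (j + n < l <= j + n + 2 * t)%N ->
      (\sum_(k < t) a k * E l k = \sum_(k < t) b k * E l k)%N.
    by move=> hl; rewrite -aE -bE; apply: (ext_length_eq exF projF fgK extA extM ip sZ).
  case: (pselect (ext_length (iota (j + n)%N) V0 = ext_length (iota (j + n)%N) V1)); last first.
    by move=> ne; exists (a, b, None); split=> //= _; rewrite -aE -bE.
  move=> /(retract_of_ext_length_eq exF projF fgK fgF isoM extA extM ip sZ fgV1).
  case=> P [pP rZ].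
  have nZ := syzygy_nonprojective exF projF fgK fgF isoM extA nM sZ.
  have [U [fgU iU nU rUZ]] := nonprojective_indec_retract hA (fg_syzygy_fg hA fgM sZ) nZ.
  case: (indec_retract_prod hA fgU iU (retract_trans rUZ rZ)) => [rUV0|rUP]; last first.
    by case: nU; apply: projective_retract rUP pP.
  have [k isok] := cV0 U fgU iU nU rUV0.
  exists (a, b, Some k); split=> //= k' [<-]; by exists Z, U.
have {data}[d dP] := choice data.
apply: (@triangular_rank t (fun i k => E (i + n)%N k) (fun j => (d j).1.1)
  (fun j => (d j).1.2) (fun j => (d j).2)).
- move=> i j lt_ji; have [+ _ _] := dP j; apply.
  by have := ltn_ord i; lia.
- by move=> j; have [_ + _] := dP j.
have clash (i j : 'I_(2 * t + 1)) k : common (i + n)%N k -> common (j + n)%N k -> ~ (i < j)%N.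
  move=> [Z [U [sZ rUZ nU isoU]]] [Z' [U' [sZ' rUZ' nU' isoU']]] lt_ij; apply: nU.
  apply: (syzygy_no_common_summand exF projF fgF isoM extA extM sZ sZ') => //.
    by have := ltn_ord j; lia.
  apply: retract_trans rUZ'; apply: retract_iso.
  exact: isomorphic_trans isoU (isomorphic_sym isoU').
move=> i j k bi bj.
have [_ _ /(_ k bi) ci] := dP i; have [_ _ /(_ k bj) cj] := dP j.
by case: (ltngtP i j) => [/(clash _ _ _ ci cj)|/(clash _ _ _ cj ci)|/val_inj].
Qed.

End Main.

(** For the second part, any finite family that contains all indecomposable
summands of the witness can serve as the [X k]. The conditions on M + A give those
on [M] and on [A] by composing with the coordinate injections. *)
Theorem theoremI (R : comPzRingType) (A : algType R) (hA : artin_algebra A) :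
  (forall (n : nat) (V : lmodType A), IT_witness n V ->
   forall t : nat, num_nonproj_indec_summands V t ->
   forall M : lmodType A, finitely_generated M ->
     (forall i, (0 < i)%N -> Ext_zero i M A^o) ->
     (forall q, (1 <= q <= 2 * t + 1)%N -> Ext_zero q M M) ->
     projective M) /\
  (Igusa_Todorov A -> Auslander_Reiten A).
Proof.
split=> [n V wV t [X [_ _ cX]] M fgM extA extM|[n [V wV]] M fgM ext].
  apply: (projective_of_ext hA wV _ fgM extA extM) => U fgU iU nU rU.
  by apply: cX; split=> //; apply: summand_retract.
have [fgV _] := wV; have [t [X cX]] := finitely_many_indec hA fgV.
apply: (projective_of_ext hA wV cX fgM) => [[//|q] _|[//|q] _] Pr f cocf.
  have [|g gP] := ext q.+1 isT Pr (lin_of (pair_linear (\0 : {linear _ -> M}) f)).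
    by move=> x; rewrite /= cocf.
  by exists (snd \o g) => x; rewrite /= -gP.
have [|g gP] := ext q.+1 isT Pr (lin_of (pair_linear f (\0 : {linear _ -> A^o}))).
  by move=> x; rewrite /= cocf.
by exists (fst \o g) => x; rewrite /= -gP.
Qed.
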